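(* There exists an absolute constant $K>0$ such that the following holds. Let $A\subset\mathbb{Z}^2\setminus\{0\}$ be finite and nonempty, and let $x\in\mathbb{Z}^2\setminus\{0\}$ with $x\notin A$ be such that $\operatorname{dist}(x,A)\ge 12(\operatorname{diam}(A)+1)$. Then for all $y\in A$ $$\mathbb{P}_x\big[\widehat{S}_{\widehat{\tau}_A}=y\mid\widehat{\tau}_A<\infty\big]=\widehat{\mathrm{hm}}_A(y)\Big(1+O\Big(\frac{\operatorname{diam}(A)}{\operatorname{dist}(x,A)}\Big)\Big),$$ that is, $$\Big|\mathbb{P}_x\big[\widehat{S}_{\widehat{\tau}_A}=y\mid\widehat{\tau}_A<\infty\big]-\widehat{\mathrm{hm}}_A(y)\Big|\le K\,\widehat{\mathrm{hm}}_A(y)\,\frac{\operatorname{diam}(A)}{\operatorname{dist}(x,A)}.$$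
   Context: Let $(S_n,n\ge 0)$ be the simple random walk on $\mathbb{Z}^2$ and $\mathbb{P}_x$ its law started from $x$; $x\sim y$ means that $x,y\in\mathbb{Z}^2$ are nearest neighbours and $\|\cdot\|$ is the Euclidean norm. The potential kernel is $a(x)=\sum_{k=0}^{\infty}\big(\mathbb{P}_0[S_k=0]-\mathbb{P}_x[S_k=0]\big)$, $x\in\mathbb{Z}^2$. (The series converges, $a(0)=0$, $a(x)>0$ for $x\ne 0$, and $a(x)=\frac14\sum_{y\sim x}a(y)$ for $x\neq 0$.) The conditioned walk $(\widehat{S}_n,n\ge 0)$ is the Markov chain on $\mathbb{Z}^2\setminus\{0\}$ with transition probabilities $\widehat{P}(x,y)=\frac{a(y)}{4a(x)}$ if $x\sim y$, $x\ne0$, and $\widehat{P}(x,y)=0$ otherwise. When applied to $\widehat{S}$, $\mathbb{P}_x$ denotes the law of $\widehat{S}$ started from $x$. Entrance and hitting times: $\widehat{\tau}_A=\min\{n\ge0:\widehat{S}_n\in A\}$ and $\widehat{\tau}^+_A=\min\{n\ge1:\widehat{S}_n\in A\}$ (with $\min\emptyset=\infty$). For finite $A\subset\mathbb{Z}^2\setminus\{0\}$: the escape probability is $\widehat{\mathrm{Es}}_A(x)=\mathbb{P}_x[\widehat{\tau}^+_A=\infty]\,\mathbf{1}\{x\in A\}$; the capacity with respect to $\widehat{S}$ is $\widehat{\mathrm{cap}}(A)=\sum_{y\in A}a^2(y)\widehat{\mathrm{Es}}_A(y)$; the harmonic measure with respect to $\widehat{S}$ is $\widehat{\mathrm{hm}}_A(y)=\dfrac{a^2(y)\widehat{\mathrm{Es}}_A(y)}{\widehat{\mathrm{cap}}(A)}$.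 Also $\operatorname{dist}(x,A)=\inf_{y\in A}\|x-y\|$ and $\operatorname{diam}(A)=\sup_{x,y\in A}\|x-y\|$. *)

(* Defs.v *)
From HB Require Import structures.
From mathcomp Require Import all_boot all_order all_algebra.
From mathcomp Require Import all_classical all_reals all_analysis.

Set Implicit Arguments.
Unset Strict Implicit.
Unset Printing Implicit Defensive.

Import Order.TTheory GRing.Theory Num.Theory.
Import numFieldNormedType.Exports.

Local Open Scope classical_set_scope.
Local Open Scope ring_scope.

Notation Z2 := (int * int)%type.

Definition enorm (R : realType) (x : Z2) : R :=
  Num.sqrt (x.1%:~R ^+ 2 + x.2%:~R ^+ 2).

Definition neighbour (x y : Z2) : bool := `|x.1 - y.1| + `|x.2 - y.2| == 1.

(* For finite nonempty A these are a true minimum and maximum. *)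
Definition dist (R : realType) (x : Z2) (A : set Z2) : R :=
  inf [set enorm R (x - y) | y in A].

Definition diam (R : realType) (A : set Z2) : R :=
  sup [set enorm R (p.1 - p.2) | p in A `*` A].

(* The last clause says
   P[X_(n+1) = z_(n+1) | X_0 = z_0, ..., X_n = z_n] = p z_n z_(n+1),
   multiplied out so that null conditioning events need no convention. *)
Definition markov_chain (R : realType) (d : measure_display)
    (Omega : measurableType d) (P : probability Omega R)
    (X : nat -> Omega -> Z2) (p : Z2 -> Z2 -> R) (x : Z2) : Prop :=
  [/\ forall n z, measurable [set w | X n w = z],
      P [set w | X 0%N w = x] = 1%E
    & forall (n : nat) (z : nat -> Z2),
        P [set w | forall i : nat, (i <= n.+1)%N -> X i w = z i] =
        (P [set w | forall i : nat, (i <= n)%N -> X i w = z i]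
         * (p (z n) (z n.+1))%:E)%E].

Definition srw_trans (R : realType) (x y : Z2) : R :=
  if neighbour x y then 4^-1 else 0.

Definition is_srw (R : realType) (d : measure_display)
    (Omega : measurableType d) (P : Z2 -> probability Omega R)
    (S : nat -> Omega -> Z2) : Prop :=
  forall x : Z2, markov_chain (P x) S (srw_trans R) x.

Definition potential_kernel (R : realType) (d : measure_display)
    (Omega : measurableType d) (P : Z2 -> probability Omega R)
    (S : nat -> Omega -> Z2) (x : Z2) : R :=
  limn (series (fun k : nat =>
    fine (P 0 [set w | S k w = 0]) - fine (P x [set w | S k w = 0]))).

Definition hat_trans (R : realType) (a : Z2 -> R) (x y : Z2) : R :=
  if neighbour x y && (x != 0) then a y / (4 * a x) else 0.

(* The state space is Z^2 \ {0}, so P 0 is unconstrained. *)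
Definition is_conditioned_walk (R : realType) (a : Z2 -> R)
    (d : measure_display) (Omega : measurableType d)
    (P : Z2 -> probability Omega R) (X : nat -> Omega -> Z2) : Prop :=
  forall x : Z2, x != 0 -> markov_chain (P x) X (hat_trans a) x.

(* min Q, where None stands for min of the empty set, i.e. infinity. *)
Definition min_time (Q : set nat) : option nat :=
  if pselect (exists n : nat, n \in Q) is left exQ
  then Some (ex_minn exQ) else None.

Definition entrance_time (Omega : Type) (X : nat -> Omega -> Z2)
    (A : set Z2) (w : Omega) : option nat :=
  min_time [set n : nat | A (X n w)].

Definition hitting_time (Omega : Type) (X : nat -> Omega -> Z2)
    (A : set Z2) (w : Omega) : option nat :=
  min_time [set n : nat | (1 <= n)%N /\ A (X n w)].

Definition escape (R : realType) (d : measure_display)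
    (Omega : measurableType d) (P : Z2 -> probability Omega R)
    (X : nat -> Omega -> Z2) (A : set Z2) (x : Z2) : R :=
  fine (P x [set w | hitting_time X A w = None]) * \1_A x.

Definition capacity (R : realType) (a : Z2 -> R) (d : measure_display)
    (Omega : measurableType d) (P : Z2 -> probability Omega R)
    (X : nat -> Omega -> Z2) (A : set Z2) : R :=
  \sum_(y \in A) (a y ^+ 2 * escape P X A y).

Definition harmonic_measure (R : realType) (a : Z2 -> R)
    (d : measure_display) (Omega : measurableType d)
    (P : Z2 -> probability Omega R) (X : nat -> Omega -> Z2)
    (A : set Z2) (y : Z2) : R :=
  a y ^+ 2 * escape P X A y / capacity a P X A.

Definition cond_prob (R : realType) (d : measure_display)
    (Omega : measurableType d) (P : probability Omega R)
    (E F : set Omega) : R :=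
  fine (P (E `&` F)) / fine (P F).

Definition entrance_finite (Omega : Type) (X : nat -> Omega -> Z2)
    (A : set Z2) : set Omega :=
  [set w | entrance_time X A w <> None].

Definition enters_at (Omega : Type) (X : nat -> Omega -> Z2)
    (A : set Z2) (y : Z2) : set Omega :=
  [set w | exists2 n : nat, entrance_time X A w = Some n & X n w = y].

(* Main.v *)
Require Import Defs.
From HB Require Import structures.
From mathcomp Require Import all_boot all_order all_algebra.
From mathcomp Require Import all_classical all_reals all_analysis.
From mathcomp Require Import ring lra zify.
Set Implicit Arguments.
Unset Strict Implicit.
Unset Printing Implicit Defensive.
Import Order.TTheory GRing.Theory Num.Theory.
Import numFieldNormedType.Exports.
Local Open Scope classical_set_scope.
Local Open Scope ring_scope.

(* Idea.  With V = A u {0}, the conditioned walk is the Doob transform by a of the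
   simple random walk killed at 0, so entering A at y from x has probability
   a(y) H(x, y) / a(x), where H is the entrance law of the simple walk into V, and
   the harmonic measure at y is proportional to a(y) Pq(y), where P averages over
   neighbours and q(z) = a(z) - E_z[a(entrance point of V)].  By time reversal
   H(x, y) = Pu(y), with u the Green function of the walk killed on V and pole x.
   Both u and q vanish on V and are harmonic off V and x, so by the minimum
   principle it suffices to compare u with kappa q on the boundary of a ball of
   radius of order diam A around A.  There q is bounded below, by comparison with
   the function log(|z|^2 + 1/2), which is subharmonic on the whole lattice, and
   u - kappa q is of order kappa diam A / dist(x, A): with g(z, x) =
   a(z) + a(x) - a(z - x), the function u - kappa q - (g(., x) - kappa a) is
   bounded and harmonic off V, and kappa is chosen so that g(., x) - kappa a
   is small near A.  The only input on a is |a(z) - a(w)| <= C |z - w| / (1 + min(|z|, |w|))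
   and logarithmic growth; both come from the fact that z.1 + z.2 and z.1 - z.2
   are independent one-dimensional walks. *)

(** Two obstacles shape the proof. The probability of ever entering A may be small, so the
    normalisation needs a relative estimate as well. Nothing makes the relative error K r / d
    smaller than 1, so the denominator a(x) - q(x) cannot be bounded below through the
    approximation; this comes from the identity a(x) - q(x) = sum over y in A of g(x, y) Pq(y) and a
    lower bound for g. The second obstacle is that the origin belongs to V. If it lies within 9 r of
    A, one logarithm centred near A bounds q below and kappa = 1 works. If it is farther away, a
    logarithm centred near A is too large at the origin; the barrier is then the mean of two
    logarithms, the balls have radius 3 r and avoid the origin, and kappa = g(y0, x) / a(y0). The
    constant 12 serves the first case, where it keeps x and x - w away from the origin for all w in
    a ball of radius 10 r + 1. Finally, the diameter is either 0, where the error term vanishes and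
    exact equality is proved, or at least 1, where it absorbs all lattice steps. *)

Definition e1 : Z2 := (1, 0).
Definition e2 : Z2 := (0, 1).

Definition nbrs (z : Z2) : seq Z2 := [:: z + e1; z - e1; z + e2; z - e2].

(** * Averages over neighbours and minimum principles *)

Section Lattice.
Variable R : realType.
Implicit Types (f g : Z2 -> R) (x y z w : Z2) (U : seq Z2).

Definition avg f z : R :=
  (f (z + e1) + f (z - e1) + f (z + e2) + f (z - e2)) / 4.

Local Notation n := (enorm R).

Lemma avgD f g z : avg (fun w => f w + g w) z = avg f z + avg g z.
Proof. by rewrite /avg; lra. Qed.

Lemma avgB f g z : avg (fun w => f w - g w) z = avg f z - avg g z.
Proof. by rewrite /avg; lra. Qed.

Lemma avgZ c f z : avg (fun w => c * f w) z = c * avg f z.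
Proof. by rewrite /avg; lra. Qed.

Lemma avgZr c f z : avg (fun w => f w * c) z = avg f z * c.
Proof. by rewrite /avg; lra. Qed.

Lemma avg_cst c z : avg (fun=> c) z = c.
Proof. by rewrite /avg; lra. Qed.

Lemma avg_shift f x z : avg (fun w => f (w - x)) z = avg f (z - x).
Proof.
by rewrite /avg (addrAC z e1) (addrAC z (- e1)) (addrAC z e2) (addrAC z (- e2)).
Qed.

Lemma avg_sum (I : Type) (s : seq I) (F : I -> Z2 -> R) z :
  avg (fun w => \sum_(i <- s) F i w) z = \sum_(i <- s) avg (F i) z.
Proof.
elim: s => [|i s IH]; first by rewrite /avg !big_nil; lra.
rewrite big_cons -IH /avg !big_cons; lra.
Qed.

Lemma eq_avg f g z : {in nbrs z, f =1 g} -> avg f z = avg g z.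
Proof.
by move=> fg; rewrite /avg !fg // /nbrs !inE eqxx ?orbT.
Qed.

Lemma ler_avg f g z : {in nbrs z, forall w, f w <= g w} -> avg f z <= avg g z.
Proof.
move=> fg; have F w : w \in nbrs z -> f w <= g w by exact: fg.
move: (F (z + e1)) (F (z - e1)) (F (z + e2)) (F (z - e2)).
rewrite /avg /nbrs !inE !eqxx ?orbT /=.
move=> /(_ isT) ? /(_ isT) ? /(_ isT) ? /(_ isT) ?; lra.
Qed.

Lemma avg_ge0 f z : {in nbrs z, forall w, 0 <= f w} -> 0 <= avg f z.
Proof. by move=> f0; rewrite -[leLHS](avg_cst 0 z); exact: ler_avg. Qed.

Lemma enorm_sqr z : n z ^+ 2 = z.1%:~R ^+ 2 + z.2%:~R ^+ 2.
Proof. by rewrite sqr_sqrtr // addr_ge0 ?sqr_ge0. Qed.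

Lemma enorm_ge0 z : 0 <= n z. Proof. exact: sqrtr_ge0. Qed.
Hint Resolve enorm_ge0 : core.

Lemma enorm0 : n 0 = 0.
Proof. by rewrite /enorm /= !expr0n /= addr0 sqrtr0. Qed.

Lemma enormN z : n (- z) = n z.
Proof. by rewrite /enorm /= !rmorphN !sqrrN. Qed.

Lemma enormC x y : n (x - y) = n (y - x).
Proof. by rewrite -enormN opprB. Qed.

Lemma enorm_ge1 z : z != 0 -> 1 <= n z.
Proof.
move=> z0; have : 1 <= z.1 ^+ 2 + z.2 ^+ 2.
  case: z z0 => i j /= ij.
  have : (i != 0) || (j != 0).
    by move: ij; apply: contraNT; rewrite negb_or !negbK => /andP[/eqP-> /eqP->].
  by case/orP => /eqP ?; nia.
rewrite -(ler_int R) rmorphD !rmorphXn /= -enorm_sqr => h.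
by rewrite -(@ler_pXn2r _ 2) ?nnegrE // expr1n.
Qed.

Lemma enorm_e1 : n e1 = 1.
Proof. by rewrite /enorm /= expr0n expr1n addr0 sqrtr1. Qed.
Lemma enorm_e2 : n e2 = 1.
Proof. by rewrite /enorm /= expr0n expr1n add0r sqrtr1. Qed.

Lemma ler_enormD x y : n (x + y) <= n x + n y.
Proof.
rewrite -(@ler_pXn2r _ 2) ?nnegrE ?addr_ge0 // sqrrD !enorm_sqr /= !rmorphD /=.
set a := x.1%:~R; set b := x.2%:~R; set c := y.1%:~R; set d := y.2%:~R.
have : a * c + b * d <= n x * n y.
  have [h|h] := leP (a * c + b * d) 0; first by apply: (le_trans h); rewrite mulr_ge0.
  rewrite -(@ler_pXn2r _ 2) // ?nnegrE ?mulr_ge0 ?(ltW h) //.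
  rewrite exprMn !enorm_sqr -/a -/b -/c -/d.
  rewrite -subr_ge0 (_ : _ - _ = (a * d - b * c) ^+ 2) ?sqr_ge0 //; ring.
lra.
Qed.

Lemma ler_enormB x y : n x - n y <= n (x - y).
Proof. by rewrite lerBlDr -[in leLHS](subrK y x) ler_enormD. Qed.

Lemma enorm_nbrs z w : w \in nbrs z -> n (w - z) = 1.
Proof.
rewrite /nbrs !inE => /or4P[] /eqP->;
  by rewrite addrC addKr ?enormN ?enorm_e1 ?enorm_e2.
Qed.

Lemma neighbourP z w : neighbour z w = (w \in nbrs z).
Proof.
rewrite /neighbour /nbrs !inE.
case: z => a b; case: w => c d /=.
rewrite -!pair_eqE /=. apply/idP/idP; lia.
Qed.

Definition box (N : nat) : seq Z2 :=
  let s := [seq k%:Z - N%:Z | k <- iota 0 (2 * N).+1] in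
  [seq (i, j) | i <- s, j <- s].

Lemma mem_box N z : (`|z.1| <= N)%N -> (`|z.2| <= N)%N -> z \in box N.
Proof.
case: z => i j /= hi hj; apply/allpairsP; exists (i, j); split => //; rewrite /fst /snd.
  apply/mapP; exists (absz (i + N%:Z)); last by lia.
  rewrite mem_iota; lia.
apply/mapP; exists (absz (j + N%:Z)); last by lia.
rewrite mem_iota; lia.
Qed.

Lemma enorm_box (K : R) : exists N, forall z, n z <= K -> z \in box N.
Proof.
exists (Num.bound K) => z zK.
have F (i : int) : i%:~R ^+ 2 <= n z ^+ 2 -> (`|i| <= Num.bound K)%N.
  move=> h; have h1 : `|i%:~R : R| <= n z.
    by rewrite -(@ler_pXn2r _ 2) ?nnegrE // real_normK // num_real.
  have := archi_boundP (le_trans (enorm_ge0 z) zK) => h2.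
  have := le_lt_trans (le_trans h1 zK) h2.
  rewrite -intr_norm -(abszE i) pmulrn ltr_int; lia.
apply: mem_box; apply: F; rewrite enorm_sqr ?lerDl ?lerDr sqr_ge0 //.
Qed.

Lemma seq_argmin (T : eqType) (d : Order.disp_t) (S : orderType d) (h : T -> S)
    (s : seq T) : s != [::] -> exists2 t, t \in s & {in s, forall u, (h t <= h u)%O}.
Proof.
elim: s => [//|x s IH] _.
have [->|/IH[y ys hy]] := eqVneq s [::].
  by exists x; [rewrite inE|move=> y; rewrite inE => /eqP->].
have [hxy|hxy] := leP (h x) (h y).
  exists x; first by rewrite inE eqxx.
  move=> t; rewrite inE => /predU1P[->//|/hy]; exact: le_trans.
exists y; first by rewrite inE ys orbT.
move=> t; rewrite inE => /predU1P[->|/hy//]; exact: ltW.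
Qed.

(* Among the minimisers in U take one with the largest first coordinate: its
   right neighbour cannot be a minimiser. *)
Lemma min_principle U f :
  {in U, forall z, avg f z <= f z} ->
  (forall z w, z \in U -> w \in nbrs z -> w \notin U -> 0 <= f w) ->
  {in U, forall z, 0 <= f z}.
Proof.
move=> fU fbd z0 z0U; rewrite leNgt; apply/negP => fz0.
have U0 : U != [::] by apply: contraTneq z0U => ->.
have [z1 z1U z1min] := seq_argmin f U0.
pose M := [seq z <- U | f z == f z1].
have M0 : M != [::].
  have : z1 \in M by rewrite mem_filter eqxx.
  by apply: contraTneq => ->.
have [z] := seq_argmin (fun z => - z.1) M0.
rewrite mem_filter => /andP[/eqP fz zU] zmax.
have fz1 : f z1 < 0 by apply: le_lt_trans (z1min _ z0U) fz0.
have F w : w \in nbrs z -> f z1 <= f w.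
  move=> wz; have [wU|wU] := boolP (w \in U); first exact: z1min.
  exact: le_trans (ltW fz1) (fbd _ _ zU wz wU).
have Fe1 : f (z + e1) = f z1.
  have := fU _ zU; rewrite /avg fz.
  move: (F (z + e1)) (F (z - e1)) (F (z + e2)) (F (z - e2)).
  rewrite /nbrs !inE !eqxx ?orbT /=.
  by move=> /(_ isT) ? /(_ isT) ? /(_ isT) ? /(_ isT) ? ?; lra.
have e1U : z + e1 \in U.
  apply/negPn/negP => /(fbd _ _ zU) ; rewrite Fe1 /nbrs !inE eqxx => /(_ isT).
  by rewrite leNgt fz1.
have := zmax (z + e1); rewrite mem_filter Fe1 eqxx e1U => /(_ isT).
by rewrite /= lerN2; lia.
Qed.

(** A lower bound on f replaces a boundary condition at infinity, which is recurrence in analytic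
    form: as a grows, f + d a is nonnegative outside a finite box, [min_principle] applies inside,
    and d tends to 0. *)
Lemma min_principle_inf (B : pred Z2) (a f : Z2 -> R) (C : R) :
  B 0 -> a 0 = 0 -> (forall z, 0 <= a z) ->
  (forall z, z != 0 -> avg a z = a z) ->
  (forall K, exists N, forall z, a z <= K -> z \in box N) ->
  (forall z, B z -> 0 <= f z) -> (forall z, ~~ B z -> avg f z <= f z) ->
  (forall z, - C <= f z) -> forall z, 0 <= f z.
Proof.
move=> B0 a0 a_ge0 aH a_inf fB fH fC z.
have [/fB//|nBz] := boolP (B z).
have z0 : z != 0 by apply: contraNneq nBz => ->.
suff F d : 0 < d -> 0 <= f z + d * a z.
  apply/ler_addgt0Pl => e e0; have a1 : 0 < 1 + a z by have := a_ge0 z; lra.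
  apply: (le_trans (F (e / (1 + a z)) _)); first by rewrite divr_gt0.
  rewrite addrC lerD2r mulrAC ler_pdivrMr // ler_wpM2l ?(ltW e0) //; lra.
move=> d0; have [N aN] := a_inf (Num.max (C / d) (a z)).
pose U := [seq w <- box N | ~~ B w].
apply: (@min_principle U (fun w => f w + d * a w)) => [w|w y wU _|].
- rewrite mem_filter => /andP[nBw _].
  have w0 : w != 0 by apply: contraNneq nBw => ->.
  by rewrite avgD avgZ aH // lerD2r fH.
- rewrite mem_filter negb_and negbK => /orP[By|yN].
    by rewrite addr_ge0 ?fB // mulr_ge0 ?a_ge0 // ltW.
  have : C / d < a y.
    rewrite ltNge; apply: contra yN => h; apply: aN.
    by rewrite le_max h.
  rewrite ltr_pdivrMr // mulrC => h; have := fC y; lra.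
- by rewrite mem_filter nBz /=; apply: aN; rewrite le_max lexx orbT.
Qed.

End Lattice.

(** * The potential kernel *)

Section PotentialKernel.
Variable R : realType.
Implicit Types (z : Z2) (s : int) (k m i j : nat).

Fixpoint srw_prob k : Z2 -> R :=
  if k is k'.+1 then avg (srw_prob k') else fun z => (z == 0)%:R.

Fixpoint walk1_prob k : int -> R :=
  if k is k'.+1 then fun s => (walk1_prob k' (s - 1) + walk1_prob k' (s + 1)) / 2
  else fun s => (s == 0)%:R.

Local Notation p := srw_prob.
Local Notation b := walk1_prob.

(* The coordinates z.1 + z.2 and z.1 - z.2 of the planar walk perform two
   independent one-dimensional walks. *)
Lemma srw_probE k z : p k z = b k (z.1 + z.2) * b k (z.1 - z.2).
Proof.
elim: k z => [|k IH] [x y] /=.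
  rewrite -natrM mulnb; congr (_%:R); congr nat_of_bool.
  rewrite -pair_eqE /=; apply/idP/idP; lia.
rewrite /avg !IH /=.
rewrite (_ : x + 1 + (y + 0) = x + y + 1); last by lia.
rewrite (_ : x + 1 - (y + 0) = x - y + 1); last by lia.
rewrite (_ : x - 1 + (y - 0) = x + y - 1); last by lia.
rewrite (_ : x - 1 - (y - 0) = x - y - 1); last by lia.
rewrite (_ : x + 0 + (y + 1) = x + y + 1); last by lia.
rewrite (_ : x + 0 - (y + 1) = x - y - 1); last by lia.
rewrite (_ : x - 0 + (y - 1) = x + y - 1); last by lia.
rewrite (_ : x - 0 - (y - 1) = x - y + 1); last by lia.
by field.
Qed.

Lemma walk1_probN k s : b k (- s) = b k s.
Proof.
elim: k s => [|k IH] s /=; first by rewrite oppr_eq0.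
have -> : - s - 1 = - (s + 1) by lia.
have -> : - s + 1 = - (s - 1) by lia.
by rewrite !IH addrC.
Qed.

Lemma walk1_prob_ge0 k s : 0 <= b k s.
Proof.
elim: k s => [|k IH] s /=; first exact: ler0n.
by rewrite divr_ge0 // addr_ge0.
Qed.

(** [b k s] is the binomial weight 2^-k C(k, (k + s) / 2), and this is the ratio of consecutive
    binomials. In multiplied form it also holds for the wrong parity and outside the support. *)
Lemma walk1_prob_rec k s :
  b k (s + 2) * (k%:R + s%:~R + 2) = b k s * (k%:R - s%:~R).
Proof.
elim: k s => [|k IH] s /=.
  have [->|s0] := eqVneq s 0; first by rewrite /= mulr0n; lra.
  rewrite mul0r; have [->|s2] := eqVneq s (-2); first by rewrite mul1r; lra.
  by rewrite (_ : s + 2 == 0 = false) ?mul0r //; apply/negP; lia.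
have := IH (s + 1); have := IH (s - 1).
rewrite (_ : s - 1 + 2 = s + 1); last by lia.
rewrite (_ : s + 1 + 2 = s + 2 + 1); last by lia.
rewrite (_ : s + 2 - 1 = s + 1); last by lia.
rewrite !rmorphD /= !rmorphN /= -(natr1 k) => h1 h2; nra.
Qed.

(** Where z.1 + z.2 is even, so is z.1 - z.2; by symmetry their halves may be taken in absolute
    value, whence the natural index. *)
Definition even_prob k i : R := b k (2 * i%:Z).
Local Notation beta := even_prob.

Lemma even_prob_ge0 k i : 0 <= beta k i. Proof. exact: walk1_prob_ge0. Qed.

Lemma even_prob_rec k i :
  beta k i.+1 * (k%:R + 2 * i%:R + 2) = beta k i * (k%:R - 2 * i%:R).
Proof.
have := walk1_prob_rec k (2 * i%:Z).
rewrite (_ : 2 * i%:Z + 2 = 2 * i.+1%:Z); last by lia.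
by rewrite /beta rmorphM /=.
Qed.

Lemma even_prob_decr k i :
  beta k i - beta k i.+1 = beta k i * ((4 * i%:R + 2) / (k%:R + 2 * i%:R + 2)).
Proof.
have d0 : (0 : R) < k%:R + 2 * i%:R + 2.
  by have := ler0n R k; have := ler0n R i; lra.
apply: (mulIf (lt0r_neq0 d0)); rewrite mulrBl even_prob_rec; field.
by rewrite gt_eqF.
Qed.

Lemma even_prob0SS k : beta k.+2 0 = beta k 0 * ((k%:R + 1) / (k%:R + 2)).
Proof.
have d0 : (0 : R) < k%:R + 2 by have := ler0n R k; lra.
rewrite /beta /= mulr0.
have -> : 0 - 1 - 1 = - 2%:Z by [].
have -> : 0 - 1 + 1 = 0 :> int by [].
have -> : 0 + 1 - 1 = 0 :> int by [].
have -> : 0 + 1 + 1 = 2%:Z by [].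
rewrite walk1_probN.
have := walk1_prob_rec k 0; rewrite add0r /= addr0 subr0 => h.
have -> : b k 2 = b k 0 * k%:R / (k%:R + 2) by rewrite -h mulfK // gt_eqF.
by field; rewrite gt_eqF.
Qed.

Lemma even_prob0_odd m : beta (2 * m).+1 0 = 0.
Proof.
elim: m => [|m IH]; last by rewrite mulnS add2n even_prob0SS IH mul0r.
by rewrite /beta /=; lra.
Qed.

Lemma even_prob00 : beta 0 0 = 1. Proof. by []. Qed.

Lemma even_prob0_sqr_le k : beta k 0 ^+ 2 <= 2 / (k%:R + 2).
Proof.
have [m {k}[->|->]] : exists m, (k = 2 * m \/ k = (2 * m).+1)%N.
  by exists (k %/ 2)%N; lia.
  2: by rewrite even_prob0_odd expr0n divr_ge0.
elim: m => [|m IH]; first by rewrite muln0 even_prob00 expr1n add0r divff.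
rewrite mulnS add2n even_prob0SS exprMn; set k := (2 * m)%N in IH *.
have k0 := ler0n R k; rewrite -(natr1 k.+1) -(natr1 k).
have d2 : 0 < k%:R + 2 :> R by lra.
have := IH; rewrite ler_pdivlMr // => h.
rewrite ler_pdivlMr; last by lra.
apply: le_trans h; rewrite -mulrA ler_wpM2l ?sqr_ge0 //.
rewrite exprMn exprVn mulrAC ler_pdivrMr ?exprn_gt0 //. nra.
Qed.

Lemma even_prob0_sqr_ge i : 1 / (4 * (i%:R + 1)) <= beta (2 * i.+1) 0 ^+ 2.
Proof.
elim: i => [|i IH].
  by rewrite muln1 even_prob0SS even_prob00 mul1r !add0r; lra.
rewrite mulnS add2n even_prob0SS exprMn; apply: le_trans (ler_wpM2r _ IH).
  rewrite natrM -!natr1; have i0 := ler0n R i.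
  rewrite -subr_ge0 (_ : _ - _ = 1 / (16 * (i%:R + 1) * (i%:R + 2) ^+ 2)); last first.
    by field; rewrite !gt_eqF //; lra.
  by rewrite divr_ge0 // !mulr_ge0 ?sqr_ge0 //; lra.
exact: sqr_ge0.
Qed.

Lemma expR_ge_poly (x : R) : 0 <= x -> (1 + x / 2) ^+ 2 <= expR x.
Proof.
move=> x0; rewrite {2}(_ : x = x / 2 + x / 2); last by field.
have := expR_ge1Dx (x / 2); rewrite expRD => h; nra.
Qed.

(** Up to 2i = k the ratio of consecutive weights is at most exp(-(2i + 1) / (k + 2)), and the odd
    numbers 2i + 1 add up to a square. Beyond, the recursion forces the next weight to be
    nonpositive. *)
Lemma even_prob_gauss k i :
  beta k i <= beta k 0 * expR (- (i%:R ^+ 2 / (k%:R + 2))).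
Proof.
have k0 := ler0n R k; have d0 : 0 < k%:R + 2 :> R by lra.
elim: i => [|i IH]; first by rewrite expr0n mul0r oppr0 expR0 mulr1.
have i0 := ler0n R i; have di : 0 < k%:R + 2 * i%:R + 2 :> R by lra.
have [ki|ki] := ltP k (2 * i)%N.
  have ki' : k%:R - 2 * i%:R < 0 :> R by rewrite subr_lt0 -natrM ltr_nat.
  have : beta k i.+1 * (k%:R + 2 * i%:R + 2) <= 0.
    by rewrite even_prob_rec mulr_ge0_le0 ?even_prob_ge0 // ltW.
  rewrite pmulr_lle0 // => h; apply: (le_trans h).
  by rewrite mulr_ge0 ?even_prob_ge0 ?expR_ge0.
have ki' : 2 * i%:R <= k%:R :> R by rewrite -natrM ler_nat.
have -> : beta k i.+1 = beta k i * (1 - (4 * i%:R + 2) / (k%:R + 2 * i%:R + 2)).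
  by rewrite mulrBr mulr1 -even_prob_decr; ring.
have h : 1 - (4 * i%:R + 2) / (k%:R + 2 * i%:R + 2)
    <= expR (- ((2 * i%:R + 1) / (k%:R + 2))) :> R.
  apply: (le_trans _ (expR_ge1Dx _)); rewrite lerD2l lerN2.
  rewrite ler_pdivrMr // mulrAC ler_pdivlMr //; nra.
have -> : - (i.+1%:R ^+ 2 / (k%:R + 2)) =
    - (i%:R ^+ 2 / (k%:R + 2)) - (2 * i%:R + 1) / (k%:R + 2) :> R.
  by rewrite -(natr1 i); field; rewrite gt_eqF.
rewrite expRD mulrA; apply: (le_trans (ler_wpM2l _ h)); first exact: even_prob_ge0.
by rewrite ler_wpM2r // expR_ge0.
Qed.

Lemma even_prob_mul_gauss k i j :
  beta k i * beta k j <=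
    beta k 0 ^+ 2 * expR (- ((i%:R ^+ 2 + j%:R ^+ 2) / (k%:R + 2))).
Proof.
rewrite mulrDl opprD expRD expr2 mulrACA.
by rewrite ler_pM ?even_prob_ge0 ?even_prob_gauss.
Qed.

(** With T = k + 2 and N = i^2 + j^2, the Gaussian factor is weakened to (T / (T + N/2))^2, so that
    the factors 1/T from the return probability and from the discrete derivative cancel and a
    summable rational function of k remains. *)
Lemma even_prob_mul_decr k i j :
  0 <= (beta k i - beta k i.+1) * beta k j <=
    (8 * i%:R + 4) / (k%:R + 2 + (i%:R ^+ 2 + j%:R ^+ 2) / 2) ^+ 2.
Proof.
have k0 := ler0n R k; have i0 := ler0n R i.
set N := _ + _ ^+ 2; have N0 : 0 <= N by rewrite addr_ge0 ?sqr_ge0.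
have bi := even_prob_ge0 k i; have bj := even_prob_ge0 k j.
rewrite even_prob_decr mulrAC; apply/andP; split.
  by rewrite mulr_ge0 ?mulr_ge0 // divr_ge0 //; lra.
pose T : R := k%:R + 2; have T0 : 0 < T by rewrite /T; lra.
have h1 : beta k i * beta k j <= 2 / T * (T / (T + N / 2)) ^+ 2.
  apply: (le_trans (even_prob_mul_gauss k i j)).
  apply: ler_pM; rewrite ?sqr_ge0 ?expR_ge0 ?even_prob0_sqr_le //.
  rewrite -[leRHS]invrK -exprVn expRN lef_pV2 ?posrE ?expR_gt0 //; last first.
    by rewrite exprn_gt0 // invr_gt0 divr_gt0 //; lra.
  have -> : (T / (T + N / 2))^-1 = 1 + (N / T) / 2.
    by field; rewrite !gt_eqF //; lra.
  by apply: expR_ge_poly; rewrite divr_ge0 // ltW.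
have h2 : (4 * i%:R + 2) / (k%:R + 2 * i%:R + 2) <= (4 * i%:R + 2) / T.
  rewrite ler_wpM2l ?lef_pV2 ?posrE /T; lra.
apply: (le_trans (ler_pM _ _ h1 h2)); first by rewrite mulr_ge0.
  by rewrite divr_ge0 //; lra.
rewrite le_eqVlt; apply/orP; left; apply/eqP; rewrite -/T; field.
by rewrite !gt_eqF //; lra.
Qed.

(** With x = k + 2 + c, the term is at most 1 / (x^2 - 1/4) = 1 / (x - 1/2) - 1 / (x + 1/2), which
    telescopes. *)
Lemma sum_inv_sqr_le (c : R) (n : nat) : 0 <= c ->
  \sum_(0 <= k < n) (k%:R + 2 + c) ^- 2 <= (3 / 2 + c)^-1.
Proof.
move=> c0; suff F : \sum_(0 <= k < n) (k%:R + 2 + c) ^- 2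
    <= (3 / 2 + c)^-1 - (n%:R + 3 / 2 + c)^-1.
  by apply: (le_trans F); rewrite gerBl invr_ge0; have := ler0n R n; lra.
elim: n => [|n IH]; first by rewrite big_nil add0r subrr.
rewrite big_nat_recr //=; apply: (le_trans (lerD IH (lexx _))).
have n0 := ler0n R n; rewrite -(natr1 n); set x : R := n%:R + 2 + c.
have x0 : 2 <= x by rewrite /x; lra.
have -> : n%:R + 3 / 2 + c = x - 2^-1 by rewrite /x; lra.
have -> : n%:R + 1 + 3 / 2 + c = x + 2^-1 by rewrite /x; lra.
rewrite -addrA lerD2l addrC -lerBrDr opprK -[leRHS]addrC.
have -> : (x - 2^-1)^-1 - (x + 2^-1)^-1 = (x ^+ 2 - 4^-1)^-1.
  field; rewrite !gt_eqF //; nra.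
rewrite lef_pV2 ?posrE; nra.
Qed.

End PotentialKernel.

(** * Convergence, gradient bound and growth on the even sublattice *)

Section PotentialKernelLimit.
Variable R : realType.
Implicit Types (z : Z2) (s t : int) (k m i j : nat) (N : nat).
Local Notation p := (@srw_prob R).
Local Notation b := (@walk1_prob R).
Local Notation beta := (@even_prob R).
Local Notation n := (enorm R).

(** Partial sums of the potential kernel at (i + j, i - j). On this sublattice every term is
    nonnegative, so the limit exists by monotonicity; at the other points the terms take both
    signs. *)
Definition even_sum N i j : R :=
  \sum_(0 <= k < N) (beta k 0 ^+ 2 - beta k i * beta k j).

Lemma even_sumC N i j : even_sum N i j = even_sum N j i.
Proof. by apply: eq_bigr => k _; rewrite (mulrC (beta k i)). Qed.

Lemma even_sum00 N : even_sum N 0 0 = 0.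
Proof. by apply: big1 => k _; rewrite expr2 subrr. Qed.

Lemma even_sum_term_ge0 k i j : 0 <= beta k 0 ^+ 2 - beta k i * beta k j.
Proof.
rewrite subr_ge0; apply: (le_trans (even_prob_mul_gauss R k i j)).
by rewrite ler_piMr ?sqr_ge0 // -expR0 ler_expR oppr_le0 divr_ge0.
Qed.

Lemma even_sum_ndecr i j : nondecreasing_seq (fun N => even_sum N i j).
Proof.
apply/nondecreasing_seqP => N; rewrite /even_sum big_nat_recr //= lerDl.
exact: even_sum_term_ge0.
Qed.

Lemma even_sum_incr N i j :
  0 <= even_sum N i.+1 j - even_sum N i j
    <= (16 * i%:R + 8) / (3 + i%:R ^+ 2 + j%:R ^+ 2).
Proof.
have -> : even_sum N i.+1 j - even_sum N i j =
    \sum_(0 <= k < N) (beta k i - beta k i.+1) * beta k j.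
  by rewrite /even_sum -sumrB; apply: eq_bigr => k _; ring.
apply/andP; split.
  by apply: sumr_ge0 => k _; case/andP: (even_prob_mul_decr R k i j).
have i0 := ler0n R i; have j0 := sqr_ge0 (j%:R : R); have ii0 := sqr_ge0 (i%:R : R).
set M := (i%:R ^+ 2 + j%:R ^+ 2) / 2 : R.
have M0 : 0 <= M by rewrite divr_ge0 // addr_ge0.
apply: (@le_trans _ _ ((8 * i%:R + 4) * (3 / 2 + M)^-1)).
  apply: le_trans (ler_wpM2l _ (sum_inv_sqr_le N M0)); last by lra.
  rewrite mulr_sumr; apply: ler_sum => k _.
  by case/andP: (even_prob_mul_decr R k i j).
rewrite le_eqVlt; apply/orP; left; apply/eqP; rewrite /M; field.
by rewrite !gt_eqF //; lra.
Qed.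

Lemma step_bound (nu : R) i i' j : 0 <= nu -> nu ^+ 2 <= i%:R ^+ 2 + j%:R ^+ 2 ->
  (i <= i')%N ->
  (16 * i'%:R + 8) / (3 + i'%:R ^+ 2 + j%:R ^+ 2) <= 24 / (1 + nu).
Proof.
move=> nu0 hnu ii'; set x : R := i'%:R; set y : R := j%:R.
have x0 : 0 <= x := ler0n R i'; have y0 : 0 <= y := ler0n R j.
have hx : nu ^+ 2 <= x ^+ 2 + y ^+ 2.
  by apply: (le_trans hnu); rewrite lerD2r ler_pXn2r ?nnegrE // ler_nat.
rewrite ler_pdivrMr; last by have := sqr_ge0 x; have := sqr_ge0 y; lra.
rewrite mulrAC ler_pdivlMr; last by lra.
have := sqr_ge0 (x - nu); have := sqr_ge0 (nu - 2); have := sqr_ge0 (x - 1); have := sqr_ge0 y; nra.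
Qed.

Lemma even_sum_mono N (nu : R) i i' j j' :
  0 <= nu -> nu ^+ 2 <= i%:R ^+ 2 + j%:R ^+ 2 -> (i <= i')%N -> (j <= j')%N ->
  0 <= even_sum N i' j' - even_sum N i j
    <= 24 * (i'%:R - i%:R + (j'%:R - j%:R)) / (1 + nu).
Proof.
have F i0 j0 l : 0 <= nu -> nu ^+ 2 <= i0%:R ^+ 2 + j0%:R ^+ 2 ->
    0 <= even_sum N (i0 + l) j0 - even_sum N i0 j0 <= 24 * l%:R / (1 + nu).
  move=> nu0 hnu; elim: l => [|l /andP[IH1 IH2]].
    by rewrite addn0 subrr mulr0 mul0r lexx.
  rewrite addnS; have /andP[h1 h2] := even_sum_incr N (i0 + l) j0.
  have := step_bound nu0 hnu (leq_addr l i0).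
  have -> : 24 * l.+1%:R / (1 + nu) = 24 * l%:R / (1 + nu) + 24 / (1 + nu).
    by rewrite -(natr1 l); ring.
  move=> h3; apply/andP; split; lra.
move=> nu0 hnu /subnKC ii' /subnKC jj'.
have := F i j (i' - i)%N nu0 hnu; rewrite ii'.
have hnu' : nu ^+ 2 <= j%:R ^+ 2 + i'%:R ^+ 2.
  apply: (le_trans hnu); rewrite addrC lerD2l ler_pXn2r ?nnegrE // ler_nat.
  by rewrite -ii' leq_addr.
have := F j i' (j' - j)%N nu0 hnu'; rewrite jj' !(even_sumC _ _ i').
rewrite -ii' -jj' !addKn !natrD => /andP[h1 h2] /andP[h3 h4].
have -> : 24 * (i%:R + (i' - i)%:R - i%:R + (j%:R + (j' - j)%:R - j%:R)) / (1 + nu)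
   = 24 * (i' - i)%:R / (1 + nu) + 24 * (j' - j)%:R / (1 + nu) by ring.
apply/andP; split; lra.
Qed.

Lemma even_sum_ub i j : exists K, forall N, even_sum N i j <= K.
Proof.
exists (24 * (i%:R - 0%:R + (j%:R - 0%:R)) / (1 + 0)) => N.
have := @even_sum_mono N 0 0 i 0 j (lexx _).
rewrite !expr0n addr0 => /(_ (lexx _) isT isT) /andP[_].
by rewrite even_sum00 subr0.
Qed.

Definition even_lim i j : R := limn (fun N => even_sum N i j).

Lemma even_sum_cvg i j : (fun N => even_sum N i j) @ \oo --> even_lim i j.
Proof.
have [K hK] := even_sum_ub i j.
apply: nondecreasing_is_cvgn; first exact: even_sum_ndecr.
by exists K => _ [N _ <-].
Qed.

Lemma even_sum_le_lim N i j : even_sum N i j <= even_lim i j.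
Proof.
apply: (@nondecreasing_cvgn_le _ (fun N => even_sum N i j)).
  exact: even_sum_ndecr.
by apply: cvgP; apply: even_sum_cvg.
Qed.

Lemma even_lim_mono (nu : R) i i' j j' :
  0 <= nu -> nu ^+ 2 <= i%:R ^+ 2 + j%:R ^+ 2 -> (i <= i')%N -> (j <= j')%N ->
  0 <= even_lim i' j' - even_lim i j
    <= 24 * (i'%:R - i%:R + (j'%:R - j%:R)) / (1 + nu).
Proof.
move=> nu0 hnu ii' jj'.
have h : (fun N => even_sum N i' j' - even_sum N i j) @ \oo -->
    even_lim i' j' - even_lim i j by apply: cvgB; exact: even_sum_cvg.
have F N := even_sum_mono N nu0 hnu ii' jj'.
apply/andP; split.
  rewrite -(cvg_lim _ h) //; apply: (limr_ge (cvgP _ h)).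
  by apply: nearW => N; case/andP: (F N).
rewrite -(cvg_lim _ h) //; apply: (limr_le (cvgP _ h)).
by apply: nearW => N; case/andP: (F N).
Qed.

(** Both points are compared with the coordinatewise maximum: along increasing paths the norm never
    drops below nu, whereas another path could pass near the origin. *)
Lemma even_lim_lip (nu : R) i i' j j' :
  0 <= nu -> nu ^+ 2 <= i%:R ^+ 2 + j%:R ^+ 2 ->
  nu ^+ 2 <= i'%:R ^+ 2 + j'%:R ^+ 2 ->
  `|even_lim i j - even_lim i' j'|
    <= 24 * (`|i%:R - i'%:R| + `|j%:R - j'%:R|) / (1 + nu).
Proof.
move=> nu0 h h'.
have /andP[a1 a2] := even_lim_mono nu0 h (leq_maxl i i') (leq_maxl j j').
have /andP[b1 b2] := even_lim_mono nu0 h' (leq_maxr i i') (leq_maxr j j').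
set L := even_lim (maxn _ _) _ in a1 a2 b1 b2.
have E (u v : nat) : `|u%:R - v%:R| = ((maxn u v)%:R - u%:R) + ((maxn u v)%:R - v%:R) :> R.
  have [uv|uv] := leqP u v.
    by rewrite distrC ger0_norm ?subr_ge0 ?ler_nat // subrr addr0.
  by rewrite ger0_norm ?subr_ge0 ?ler_nat ?(ltnW uv) // subrr add0r.
rewrite !E.
set A := (X in 24 * X / _) in a2; set B := (X in 24 * X / _) in b2.
have -> : 24 * ((maxn i i')%:R - i%:R + ((maxn i i')%:R - i'%:R) +
   ((maxn j j')%:R - j%:R + ((maxn j j')%:R - j'%:R))) / (1 + nu) =
   24 * A / (1 + nu) + 24 * B / (1 + nu) by rewrite /A /B; ring.
rewrite ler_norml; apply/andP; split; lra.
Qed.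

Lemma even_lim_ge1 i j : (0 < i + j)%N -> 1 <= even_lim i j.
Proof.
move=> ij; apply: le_trans (even_sum_le_lim 1 i j).
rewrite /even_sum big_nat1 even_prob00 expr1n.
have [i0|i0] := posnP i; [have j0 : (0 < j)%N by lia|].
  by rewrite /even_prob /= (_ : 2 * j%:Z == 0 = false) ?mulr0 ?subr0 //; apply/negP; lia.
by rewrite /even_prob /= (_ : 2 * i%:Z == 0 = false) ?mul0r ?subr0 //; apply/negP; lia.
Qed.

Lemma ln_le_harmonic N : ln (N%:R + 1) <= \sum_(0 <= k < N) (k%:R + 1)^-1 :> R.
Proof.
elim: N => [|N IH]; first by rewrite big_nil add0r ln1.
rewrite big_nat_recr //=; have N0 := ler0n R N; rewrite -(natr1 N).
have N1 : 0 < N%:R + 1 :> R by lra.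
have -> : N%:R + 1 + 1 = (N%:R + 1) * (1 + (N%:R + 1)^-1) :> R.
  by field; rewrite gt_eqF.
have i0 : 0 < (N%:R + 1)^-1 :> R by rewrite invr_gt0.
have i1 : 0 < 1 + (N%:R + 1)^-1 :> R by lra.
rewrite lnM ?posrE //; apply: lerD IH _; apply: le_ln1Dx; lra.
Qed.

(** Only even times k with k + 2 <= N = i^2 + j^2 are used: there the Gaussian factor is at most
    1/2, each term is at least half the return probability, and these dominate a harmonic sum. The
    argument of the logarithm is |z|^2 + 1/2 at z = (i + j, i - j). *)
Lemma even_lim_growth i j :
  8^-1 * (ln (2 * (i%:R ^+ 2 + j%:R ^+ 2) + 2^-1) - ln 8) <= even_lim i j.
Proof.
set N := (i ^ 2 + j ^ 2)%N.
have hN : i%:R ^+ 2 + j%:R ^+ 2 = N%:R :> R by rewrite /N natrD !natrX.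
rewrite hN.
set K := (N %/ 2).-1%N.
have F M : (M <= K)%N ->
    8^-1 * (\sum_(0 <= k < M) (k%:R + 1)^-1) <= even_sum (2 * M).+1 i j.
  elim: M => [|M IH] MK.
    by rewrite big_nil mulr0 /even_sum big_nat1 even_sum_term_ge0.
  rewrite big_nat_recr //= mulrDr mulnS add2n /even_sum big_nat_recr //=.
  apply: lerD.
    apply: (le_trans (IH (ltnW MK))); rewrite /even_sum [leRHS]big_nat_recr //= lerDl.
    exact: even_sum_term_ge0.
  have -> : ((2 * M).+2 = 2 * M.+1)%N by lia.
  set k := (2 * M.+1)%N.
  apply: (@le_trans _ _ (2^-1 * beta k 0 ^+ 2)).
    rewrite (_ : 8^-1 * _ = 2^-1 * (1 / (4 * (M%:R + 1)))); last first.
      by field; rewrite gt_eqF // natr1.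
    by rewrite ler_pM2l // even_prob0_sqr_ge.
  rewrite lerBrDr -lerBrDl; apply: (le_trans (even_prob_mul_gauss R k i j)).
  rewrite (_ : _ - _ = beta k 0 ^+ 2 * 2^-1); last by field.
  rewrite ler_wpM2l ?sqr_ge0 // expRN lef_pV2 ?posrE ?expR_gt0 //.
  apply: le_trans (expR_ge1Dx _); rewrite -lerBlDl (_ : 2 - 1 = 1 :> R); last by lra.
  rewrite hN ler_pdivlMr ?mul1r; last by rewrite -natrD ltr0n addn2.
  by rewrite -natrD ler_nat /k; rewrite /K in MK; lia.
apply: le_trans (even_sum_le_lim (2 * K).+1 i j).
apply: le_trans (F K (leqnn K)); rewrite ler_pM2l //.
apply: le_trans (ln_le_harmonic K).
have N0 := ler0n R N; have K0 := ler0n R K.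
rewrite lerBlDr -lnM ?posrE ?ler_ln ?posrE; try lra.
have : (N%:R : R) <= (2 * K + 3)%:R by rewrite ler_nat /K; lia.
by rewrite natrD natrM; lra.
Qed.

End PotentialKernelLimit.

(** * The potential kernel on the whole lattice: harmonicity, growth, Lipschitz bound *)

Section Potential.
Variable R : realType.
Implicit Types (z w : Z2) (s t : int) (k i j N : nat).
Local Notation p := (@srw_prob R).
Local Notation b := (@walk1_prob R).
Local Notation beta := (@even_prob R).
Local Notation n := (enorm R).

Definition log_norm z : R := ln (n z ^+ 2 + 2^-1).

(** The shift 1/2 serves the algebra: with T = |z|^2 + 3/2, the product of the four neighbouring
    values minus (T - 1)^4 loses its terms T^4, T^3 and T^2, and 16 x^2 y^2 + 4 T - 1 remains, which
    is positive even at the origin. *)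
Lemma log_norm_subharmonic z : log_norm z <= avg log_norm z.
Proof.
case: z => u v; rewrite /avg /log_norm !enorm_sqr /=.
rewrite ?addr0 ?subr0 !rmorphD /= !rmorphN /=.
set x : R := u%:~R; set y : R := v%:~R.
have x2 := sqr_ge0 x; have y2 := sqr_ge0 y.
have P1 := sqr_ge0 (x + 1); have P2 := sqr_ge0 (x - 1).
have P3 := sqr_ge0 (y + 1); have P4 := sqr_ge0 (y - 1).
rewrite ler_pdivlMr // -!lnM ?posrE ?mulr_gt0 //; try lra.
rewrite mulr_natr -lnXn; last by lra.
rewrite ler_ln ?posrE ?exprn_gt0 ?mulr_gt0 //; try lra.
set T := x ^+ 2 + y ^+ 2 + 3 / 2.
rewrite -subr_ge0 (_ : _ - _ = 16 * x ^+ 2 * y ^+ 2 + 4 * T - 1); last first.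
  by rewrite /T; field.
have : 0 <= x ^+ 2 * y ^+ 2 by rewrite mulr_ge0.
rewrite /T; lra.
Qed.

Definition potential_sum N z : R := \sum_(0 <= k < N) (p k 0 - p k z).
Definition potential z : R := limn (fun N => potential_sum N z).
Local Notation a := potential.

Definition even_point s t : Z2 := (s + t, s - t).

(** Statements proved on the even sublattice pass to the other points through their neighbours. *)
Lemma even_point_or_nbrs z :
  (exists s t, z = even_point s t) \/
  {in nbrs z, forall w, exists s t, w = even_point s t}.
Proof.
case: z => x y.
have E (u v : int) : ((u + v) %% 2)%Z = 0 -> exists s t, (u, v) = even_point s t.
  move=> h; pose q := ((u + v) %/ 2)%Z; exists q, (u - q); rewrite /q {q}.
  rewrite /even_point; congr pair; lia.
have [h|h] : ((x + y) %% 2)%Z = 0 \/ ((x + y) %% 2)%Z = 1 by lia.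
  by left; exact: E.
right=> w; rewrite /nbrs !inE => /or4P[] /eqP->; apply: E => /=; lia.
Qed.

Lemma srw_prob_even k s t : p k (even_point s t) = beta k `|s| * beta k `|t|.
Proof.
rewrite srw_probE /even_point /=.
have -> : s + t + (s - t) = 2 * s by lia.
have -> : s + t - (s - t) = 2 * t by lia.
rewrite /even_prob; congr (_ * _).
  have [s0|s0] := leP 0 s; first by congr (b k _); lia.
  by rewrite -walk1_probN; congr (b k _); lia.
have [s0|s0] := leP 0 t; first by congr (b k _); lia.
by rewrite -walk1_probN; congr (b k _); lia.
Qed.

Lemma srw_prob0 k : p k 0 = beta k 0 ^+ 2.
Proof. exact: (srw_prob_even k 0 0). Qed.

Lemma potential_sum_even N s t :
  potential_sum N (even_point s t) = even_sum R N `|s| `|t|.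
Proof. by apply: eq_bigr => k _; rewrite srw_prob_even srw_prob0. Qed.

(** The shift in time leaves over the last return term [p N 0] and, at z, the term of time 0. As
    [p N 0] tends to 0, this yields convergence at odd points and, in the limit, harmonicity off the
    origin. *)
Lemma potential_sumS N z :
  potential_sum N.+1 z = p N 0 + avg (potential_sum N) z - (z == 0)%:R.
Proof.
have -> : avg (potential_sum N) z = \sum_(0 <= k < N) (p k 0 - avg (p k) z).
  by rewrite /potential_sum avg_sum; apply: eq_bigr => k _; rewrite avgB avg_cst.
rewrite /potential_sum !sumrB big_nat_recr //= [X in _ - X]big_nat_recl //=; ring.
Qed.

Lemma potential_even s t : a (even_point s t) = even_lim R `|s| `|t|.
Proof.
by rewrite /a; congr (limn _); apply/funext => N; rewrite potential_sum_even.
Qed.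

Lemma srw_prob0_cvg0 : p N 0 @[N --> \oo] --> (0 : R).
Proof.
apply: (@squeeze_cvgr _ _ _ _ (fun=> 0) (fun N => 2 * (N.+1%:R)^-1)).
- apply: nearW => N; rewrite srw_prob0 sqr_ge0 /=.
  apply: (le_trans (even_prob0_sqr_le R N)); rewrite ler_pM2l //.
  by have := ler0n R N; rewrite -(natr1 N) => N0; rewrite lef_pV2 ?posrE; lra.
- exact: cvg_cst.
- by rewrite -(mulr0 2); apply: cvgM; [exact: cvg_cst|exact: cvg_harmonic].
Qed.

Lemma avg_cvg (F : nat -> Z2 -> R) (f : Z2 -> R) z :
  {in nbrs z, forall w, F N w @[N --> \oo] --> f w} ->
  avg (F N) z @[N --> \oo] --> avg f z.
Proof.
move=> h; apply: cvgMr_tmp; apply: cvgD; last by apply: h; rewrite !inE eqxx ?orbT.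
apply: cvgD; last by apply: h; rewrite !inE eqxx ?orbT.
by apply: cvgD; apply: h; rewrite !inE eqxx ?orbT.
Qed.

Lemma potential_sum_cvg z : potential_sum N z @[N --> \oo] --> a z.
Proof.
have E s t : potential_sum N (even_point s t) @[N --> \oo] --> a (even_point s t).
  rewrite potential_even; under eq_fun do rewrite potential_sum_even.
  exact: even_sum_cvg.
have [[s [t ->]]|h] := even_point_or_nbrs z; first exact: E.
suff: cvgn (fun N => potential_sum N z) by [].
apply/cvg_ex; exists (0 + avg a z - (z == 0)%:R).
rewrite -(cvg_shiftS (fun N => potential_sum N z)) /=.
under eq_fun do rewrite potential_sumS.
apply: cvgB; last exact: cvg_cst.
apply: cvgD; first exact: srw_prob0_cvg0.
by apply: avg_cvg => w /h[s [t ->]]; exact: E.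
Qed.

Lemma avg_potential z : avg a z = a z + (z == 0)%:R.
Proof.
have h1 : potential_sum N.+1 z @[N --> \oo] --> a z.
  by rewrite (cvg_shiftS (fun N => potential_sum N z)); exact: potential_sum_cvg.
have h2 : potential_sum N.+1 z @[N --> \oo] --> 0 + avg a z - (z == 0)%:R.
  under eq_fun do rewrite potential_sumS.
  apply: cvgB; last exact: cvg_cst.
  apply: cvgD; first exact: srw_prob0_cvg0.
  by apply: avg_cvg => w _; exact: potential_sum_cvg.
by rewrite (cvg_unique _ h1 h2) // add0r subrK.
Qed.

Lemma potential0 : a 0 = 0.
Proof.
rewrite /a (_ : (fun N => _) = fun=> 0) ?lim_cst //.
by apply/funext => N; apply: big1 => k _; rewrite subrr.
Qed.

Lemma potentialN z : a (- z) = a z.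
Proof.
rewrite /a; congr (limn _); apply/funext => N; apply: eq_bigr => k _.
congr (_ - _); rewrite !srw_probE /= -walk1_probN.
by rewrite -[X in _ * X]walk1_probN; congr (b k _ * b k _); lia.
Qed.

(** At even points the first term of the series already gives 1. An odd point averages four even
    neighbours, at least one of z + e1, z - e1 and one of z + e2, z - e2 being nonzero, whence
    2/4. *)
Lemma potential_ge_half z : z != 0 -> 2^-1 <= a z.
Proof.
have E s t : even_point s t != 0 -> 1 <= a (even_point s t).
  move=> h; rewrite potential_even even_lim_ge1 //.
  move: h; rewrite /even_point -pair_eqE /=; lia.
have E0 s t : 0 <= a (even_point s t).
  have [->|/E] := eqVneq (even_point s t) 0; first by rewrite potential0.
  exact: le_trans.
move=> z0; have [[s [t zst]]|h] := even_point_or_nbrs z.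
  by rewrite zst in z0 *; apply: le_trans (E _ _ z0); lra.
rewrite -[leRHS]addr0 -[0](_ : (z == 0)%:R = _); last by rewrite (negbTE z0).
rewrite -avg_potential /avg.
have F w : w \in nbrs z -> 0 <= a w by move=> /h[s [t ->]].
have F1 w : w \in nbrs z -> w != 0 -> 1 <= a w by move=> /h[s [t ->]]; exact: E.
have i1 : z + e1 \in nbrs z by rewrite !inE eqxx ?orbT.
have i2 : z - e1 \in nbrs z by rewrite !inE eqxx ?orbT.
have i3 : z + e2 \in nbrs z by rewrite !inE eqxx ?orbT.
have i4 : z - e2 \in nbrs z by rewrite !inE eqxx ?orbT.
have := F _ i1; have := F _ i2; have := F _ i3; have := F _ i4.
have : (z + e1 != 0) || (z - e1 != 0).
  by rewrite -!pair_eqE /=; lia.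
have : (z + e2 != 0) || (z - e2 != 0).
  by rewrite -!pair_eqE /=; lia.
case/orP => [/(F1 _ i3)|/(F1 _ i4)] ?; case/orP => [/(F1 _ i1)|/(F1 _ i2)] ? ? ? ? ?; lra.
Qed.

Lemma potential_ge0 z : 0 <= a z.
Proof.
have [->|/potential_ge_half] := eqVneq z 0; first by rewrite potential0.
by apply: le_trans.
Qed.

Lemma enorm_even_sqr s t :
  n (even_point s t) ^+ 2 = 2 * ((absz s)%:R ^+ 2 + (absz t)%:R ^+ 2).
Proof.
have E (u : int) : (absz u)%:R ^+ 2 = u%:~R ^+ 2 :> R.
  by rewrite pmulrn abszE intr_norm real_normK // num_real.
by rewrite enorm_sqr !E /= rmorphB rmorphD /=; ring.
Qed.

Lemma potential_growth z : 8^-1 * (log_norm z - ln 8) <= a z.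
Proof.
have E s t : 8^-1 * (log_norm (even_point s t) - ln 8) <= a (even_point s t).
  by rewrite potential_even /log_norm enorm_even_sqr even_lim_growth.
have [->|z0] := eqVneq z 0.
  by rewrite (_ : 0 = even_point 0 0).
have [[s [t ->]]|h] := even_point_or_nbrs z; first exact: E.
have := avg_potential z; rewrite (negbTE z0) addr0 => <-.
apply: (@le_trans _ _ (avg (fun w => 8^-1 * (log_norm w - ln 8)) z)).
  by rewrite avgZ avgB avg_cst ler_pM2l // lerD2r log_norm_subharmonic.
by apply: ler_avg => w /h[s [t ->]]; exact: E.
Qed.

Lemma potential_proper K : exists N, forall z, a z <= K -> z \in box N.
Proof.
have [N hN] := @enorm_box R (expR (8 * K + ln 8) + 1).
exists N => z az; apply: hN.
have h : log_norm z <= 8 * K + ln 8.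
  have := le_trans (potential_growth z) az; lra.
have n0 := enorm_ge0 R z.
move: h; rewrite -ler_expR /log_norm lnK ?posrE; last by have := sqr_ge0 (n z); lra.
by have := sqr_ge0 (n z - 1); nra.
Qed.

Lemma potential_lip_even s t s' t' (mu : R) : 0 <= mu ->
  mu <= n (even_point s t) -> mu <= n (even_point s' t') ->
  `|a (even_point s t) - a (even_point s' t')| * (1 + mu)
    <= 48 * n (even_point s t - even_point s' t').
Proof.
move=> mu0 h h'.
have F u v : mu <= n (even_point u v) ->
    (mu / 2) ^+ 2 <= (absz u)%:R ^+ 2 + (absz v)%:R ^+ 2.
  move=> hu; have : mu ^+ 2 <= n (even_point u v) ^+ 2.
    by rewrite ler_pXn2r ?nnegrE ?enorm_ge0.
  by rewrite enorm_even_sqr exprMn; have := sqr_ge0 mu; lra.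
have m2 : 0 <= mu / 2 by lra.
have := even_lim_lip m2 (F _ _ h) (F _ _ h'); rewrite -!potential_even.
rewrite ler_pdivlMr; last by lra.
have := normr_ge0 (a (even_point s t) - a (even_point s' t')).
set D := `|a _ - a _| => D0 hD.
suff : `|(absz s)%:R - (absz s')%:R| + `|(absz t)%:R - (absz t')%:R|
    <= n (even_point s t - even_point s' t') by nra.
have G u u' : `|(absz u)%:R - (absz u')%:R| <= `|u%:~R - u'%:~R| :> R.
  by rewrite !pmulrn !abszE !intr_norm ler_dist_dist.
apply: (le_trans (lerD (G _ _) (G _ _))).
rewrite -(@ler_pXn2r _ 2) ?nnegrE ?enorm_ge0 ?addr_ge0 //.
rewrite enorm_sqr /= !(rmorphD, rmorphN) /=.
set x := s%:~R - _; set y := t%:~R - _.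
rewrite sqrrD !real_normK ?num_real //.
have h1 := sqr_ge0 (`|x| - `|y|); move: h1; rewrite sqrrB !real_normK ?num_real //.
rewrite (_ : _ ^+ 2 + _ ^+ 2 = 2 * (x ^+ 2 + y ^+ 2)); last by rewrite /x /y; ring.
lra.
Qed.

Lemma potential_lip z w (mu : R) : 0 <= mu -> mu <= n z -> mu <= n w ->
  `|a z - a w| * (1 + mu) <= 768 * n (z - w).
Proof.
(* Points off the even sublattice are averages of their even neighbours. *)
have avg_lip C z0 w0 : 0 <= C -> z0 != 0 -> z0 != w0 ->
    (forall u (nu : R), u \in nbrs z0 -> 0 <= nu -> nu <= n u -> nu <= n w0 ->
       `|a u - a w0| * (1 + nu) <= C * n (u - w0)) ->
    forall nu : R, 0 <= nu -> nu <= n z0 -> nu <= n w0 ->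
      `|a z0 - a w0| * (1 + nu) <= 4 * C * n (z0 - w0).
  move=> C0 z00 zw hu nu nu0 nz nw.
  have n1 : 1 <= n (z0 - w0) by rewrite enorm_ge1 // subr_eq0.
  (* A neighbour of z0 may be closer to the origin by 1; nu' stays below its norm and 1 + nu <= 2 (1
     + nu'). The other factor 2 comes from |u - w0| <= 2 |z0 - w0|. Used at one endpoint and then at
     the other, this turns 48 into 192 and 768. *)
  pose nu' := Num.max 0 ((nu - 1) / 2).
  have nu'0 : 0 <= nu' by rewrite le_max lexx.
  have hnu : 1 + nu <= 2 * (1 + nu').
    have : (nu - 1) / 2 <= nu' by rewrite le_max lexx orbT.
    by lra.
  have F u : u \in nbrs z0 -> `|a u - a w0| <= C * (2 * n (z0 - w0)) / (1 + nu').
    move=> uz; rewrite ler_pdivlMr; last by lra.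
    have d1 := enorm_nbrs R uz.
    apply: (le_trans (hu u nu' uz nu'0 _ _)).
    - rewrite ge_max enorm_ge0 /=.
      have d1' : n (z0 - u) = 1 by rewrite enormC.
      have := enorm_ge0 R u; have := ler_enormB R z0 (z0 - u).
      by rewrite d1' subKr; lra.
    - by rewrite ge_max enorm_ge0 /=; lra.
    - rewrite ler_wpM2l //.
      by have := ler_enormD R (u - z0) (z0 - w0); rewrite subrKA d1; lra.
  have F' : `|a z0 - a w0| <= C * (2 * n (z0 - w0)) / (1 + nu').
    have -> : a z0 - a w0 = avg (fun u => a u - a w0) z0.
      by rewrite avgB avg_cst avg_potential (negbTE z00) addr0.
    rewrite ler_norml; apply/andP; split.
      rewrite -[leLHS](@avg_cst R _ z0); apply: ler_avg => u /F.
      by rewrite ler_norml => /andP[].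
    rewrite -[leRHS](@avg_cst R _ z0); apply: ler_avg => u /F.
    by rewrite ler_norml => /andP[].
  move: F'; rewrite ler_pdivlMr; last by lra.
  by have := normr_ge0 (a z0 - a w0); nra.
have [<-|zw] := eqVneq z w.
  by move=> mu0 _ _; rewrite !subrr normr0 mul0r enorm0 mulr0.
have even0 u : (forall s t, u <> even_point s t) -> u != 0.
  by move=> hu; apply/eqP => u0; apply: (hu 0 0); rewrite u0.
have half_even z0 w0 : z0 != w0 -> (exists s t, w0 = even_point s t) ->
    forall nu : R, 0 <= nu -> nu <= n z0 -> nu <= n w0 ->
      `|a z0 - a w0| * (1 + nu) <= 192 * n (z0 - w0).
  move=> zw0 [s' [t' ew]] nu nu0 nz nw.
  have [[s [t ez]]|ho] := even_point_or_nbrs z0.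
    apply: (@le_trans _ _ (48 * n (z0 - w0))).
      by rewrite ez ew; apply: potential_lip_even; rewrite -?ez -?ew.
    by have := enorm_ge0 R (z0 - w0); lra.
  have [e0|z00] := eqVneq z0 0.
    apply: (@le_trans _ _ (48 * n (z0 - w0))).
      have e00 : z0 = even_point 0 0 by rewrite e0.
      by rewrite e00 ew; apply: potential_lip_even; rewrite -?e00 -?ew.
    by have := enorm_ge0 R (z0 - w0); lra.
  rewrite (_ : 192 = 4 * 48); last by lra.
  apply: (avg_lip 48) => // u nu1 /ho[s [t ->]] h1 h2 h3.
  by rewrite ew; apply: potential_lip_even; rewrite -?ew.
move=> mu0 hz hw.
have [ez|ho] := even_point_or_nbrs z.
  rewrite distrC enormC; apply: (@le_trans _ _ (192 * n (w - z))).
    by apply: half_even; rewrite // eq_sym.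
  by have := enorm_ge0 R (w - z); lra.
have [e0|z00] := eqVneq z 0.
  rewrite distrC enormC; apply: (@le_trans _ _ (192 * n (w - z))).
    by apply: half_even; rewrite 1?eq_sym //; exists 0, 0; rewrite e0.
  by have := enorm_ge0 R (w - z); lra.
rewrite (_ : 768 = 4 * 192); last by lra.
apply: (avg_lip 192) => // u nu1 /ho eu h1 h2 h3.
have [->|uw] := eqVneq u w.
  by rewrite subrr normr0 mul0r subrr enorm0 mulr0.
by rewrite distrC enormC; apply: half_even; rewrite 1?eq_sym.
Qed.

End Potential.

(** * Green functions *)

Section Green.
Variable R : realType.
Implicit Types (x y z w : Z2) (N m : nat).
Local Notation a := (@potential R).
Local Notation n := (enorm R).
Hint Resolve enorm_ge0 : core.

Lemma potential_min_principle (B : pred Z2) (f : Z2 -> R) (C : R) :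
  B 0 -> (forall z, B z -> 0 <= f z) -> (forall z, ~~ B z -> avg f z <= f z) ->
  (forall z, - C <= f z) -> forall z, 0 <= f z.
Proof.
move=> B0; apply: (@min_principle_inf R B a) => //.
- exact: potential0.
- exact: potential_ge0.
- by move=> z z0; rewrite avg_potential (negbTE z0) addr0.
- exact: potential_proper.
Qed.

Lemma potential_lipschitz : exists2 C : R, 1 <= C &
  forall z w (mu : R), 0 <= mu -> mu <= n z -> mu <= n w ->
    `|a z - a w| * (1 + mu) <= C * n (z - w).
Proof. by exists 768; [lra|exact: potential_lip]. Qed.

(* The Green function of the walk killed at the origin. *)
Definition green0 z x : R := a z + a x - a (z - x).

Lemma green0C z x : green0 z x = green0 x z.
Proof. by rewrite /green0 -(potentialN _ (z - x)) opprB (addrC (a z)). Qed.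

Lemma green00 x : green0 0 x = 0.
Proof. by rewrite /green0 sub0r potentialN potential0 add0r subrr. Qed.

Lemma avg_green0 x z :
  avg (green0 ^~ x) z = green0 z x + (z == 0)%:R - (z == x)%:R.
Proof.
rewrite /green0 avgB avgD avg_cst avg_shift !avg_potential subr_eq0.
by ring.
Qed.

Lemma green0_bounded x : exists C, forall z, `|a z - a (z - x)| <= C.
Proof.
have [C _ lip] := potential_lipschitz; exists (C * n x) => z.
have := lip z (z - x) 0 (lexx _) (enorm_ge0 _ _) (enorm_ge0 _ _).
by rewrite addr0 mulr1 subKr.
Qed.

Lemma green0_ge0 z x : 0 <= green0 z x.
Proof.
have [C hC] := green0_bounded x.
apply: (@potential_min_principle (pred1 0) (green0 ^~ x) C).
- by rewrite /= eqxx.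
- by move=> w /eqP->; rewrite green00.
- by move=> w /negbTE /= w0; rewrite avg_green0 w0 addr0 gerBl.
- move=> w; have := hC w; rewrite ler_norml => /andP[h _].
  by apply: (le_trans h); rewrite /green0 addrAC lerDl potential_ge0.
Qed.

(** Nonnegativity of [green0] at (z - x, - x) is the subadditivity a(z) <= a(z - x) + a(x). *)
Lemma green0_ler z x : green0 z x <= 2 * a x.
Proof.
have := green0_ge0 (z - x) (- x).
by rewrite /green0 potentialN opprK subrK; lra.
Qed.

Lemma green0_lel z x : green0 z x <= 2 * a z.
Proof. by rewrite green0C green0_ler. Qed.

(** At distance at least M |x| from the origin, a(w) and a(w - x) differ by at most 1/4 <= a(x) / 2,
    so [green0] is at least a(x) / 2, while a is at most L a(x) on the layer just outside that ball.
    Inside, both functions vanish at 0 and the pole x only makes [green0] superharmonic, so the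
    minimum principle carries the comparison inward. *)
Lemma green0_ge : exists2 c : R, 0 < c &
  forall z x, n z <= 4 * n x -> c * a z <= green0 z x.
Proof.
have [C C1 lip] := potential_lipschitz.
pose M : R := 4 * C + 1; pose L : R := 1 + 2 * (C * (M + 2)).
have L0 : 0 < L by rewrite /L /M; nra.
exists (2 * L)^-1; first by rewrite invr_gt0; lra.
move=> z x zx; have [x0|x0] := eqVneq x 0.
  have z0 : z = 0.
    apply/eqP; apply: contraTT zx => /(enorm_ge1 R) z1.
    by rewrite x0 enorm0 mulr0 -ltNge; lra.
  by rewrite z0 potential0 mulr0 green00.
have nx := enorm_ge1 R x0; have ax := potential_ge_half R x0.
have far w : M * n x <= n w -> 2^-1 * a x <= green0 w x.
  move=> hw; have h1 := ler_enormB R w x.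
  have := lip w (w - x) (4 * C * n x).
  rewrite subKr.
  have F1 : 0 <= 4 * C * n x by rewrite mulr_ge0 //; lra.
  have F2 : 4 * C * n x <= n w by move: hw; rewrite /M; lra.
  have F3 : 4 * C * n x <= n (w - x) by move: hw; rewrite /M; lra.
  move=> /(_ F1 F2 F3) h2.
  have : `|a w - a (w - x)| <= 4^-1.
    have Cx : 0 < C * n x by rewrite mulr_gt0; lra.
    rewrite -(ler_pM2r (_ : 0 < 4 * (C * n x))); last by lra.
    have := normr_ge0 (a w - a (w - x)); move: h2; set D := `|_|; lra.
  by rewrite ler_norml /green0 => /andP[]; lra.
have layer w : M * n x <= n w -> n w <= M * n x + 1 -> a w <= L * a x.
  move=> hw1 hw2; have := lip w x (n x) (enorm_ge0 _ _).
  have F1 : n x <= n w by apply: le_trans hw1; rewrite /M; nra.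
  move=> /(_ F1 (lexx _)) h2; have h3 : n (w - x) <= (M + 2) * n x.
    by have := ler_enormD R w (- x); rewrite enormN; lra.
  have : `|a w - a x| <= C * (M + 2).
    rewrite -(ler_pM2r (_ : 0 < 1 + n x)); last by lra.
    apply: (le_trans h2); rewrite -mulrA ler_pM2l; last by lra.
    have M2 : 0 <= M + 2 by rewrite /M; lra.
    by apply: (le_trans h3); rewrite ler_wpM2l //; lra.
  have CM : 0 <= C * (M + 2) by rewrite mulr_ge0 // /M; lra.
  rewrite ler_norml => /andP[_]; rewrite /L; move: CM; set P := C * _; nra.
have [N hN] := enorm_box (M * n x).
pose U := [seq w <- box N | (w != 0) && (n w < M * n x)].
have [->|z0] := eqVneq z 0; first by rewrite potential0 mulr0 green00.
rewrite -subr_ge0.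
apply: (@min_principle R U (fun w => green0 w x - (2 * L)^-1 * a w)).
- move=> w; rewrite mem_filter => /andP[/andP[w0 _] _].
  rewrite avgB avgZ avg_green0 avg_potential (negbTE w0) !addr0.
  by rewrite lerD2r gerBl.
- move=> w v; rewrite mem_filter => /andP[/andP[w0 wM] _] vw vU.
  have [->|v0] := eqVneq v 0; first by rewrite green00 potential0 mulr0 subrr.
  have hv : n v <= n w + 1.
    by have := ler_enormB R v w; rewrite (enorm_nbrs R vw); lra.
  have vM : M * n x <= n v.
    rewrite leNgt; apply: contra vU => vM.
    by rewrite mem_filter v0 vM hN // ltW.
  rewrite subr_ge0; apply: le_trans (far _ vM).
  have := layer v vM; rewrite invfM -mulrA ler_pM2l // ler_pdivrMl // => -> //.
  by lra.
- rewrite mem_filter z0 /=.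
  have zM : n z < M * n x by apply: (le_lt_trans zx); rewrite ltr_pM2r /M; lra.
  by rewrite zM hN // ltW.
Qed.

End Green.

(** * Simple walk killed on A and the origin: Green function, entrance and escape *)

Section KilledWalk.
Variables (R : realType) (A : seq Z2).
Implicit Types (x y z w : Z2) (N m : nat) (f : Z2 -> R).
Local Notation a := (@potential R).
Local Notation n := (enorm R).
Hint Resolve enorm_ge0 : core.

Definition killing z : bool := (z == 0) || (z \in A).
Local Notation V := killing.

Lemma killing0 : V 0. Proof. by rewrite /killing eqxx. Qed.

Lemma killing_mem y : y \in A -> V y.
Proof. by move=> yA; rewrite /killing yA orbT. Qed.

Lemma nkilling_neq0 z : ~~ V z -> z != 0.
Proof. by rewrite negb_or => /andP[]. Qed.

Definition killed f z : R := if V z then 0 else avg f z.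

(* The probability, for the walk killed on V, of being at y at time m when started
   from z; a walk reaching a point of V is still counted at that time. *)
Definition visit m y : Z2 -> R := iter m killed (fun z => (z == y)%:R).

Arguments visit : simpl never.

Lemma visitS m y z : visit m.+1 y z = if V z then 0 else avg (visit m y) z.
Proof. by []. Qed.

Lemma visit_ge0 m y z : 0 <= visit m y z.
Proof.
elim: m z => [|m IH] z; first exact: ler0n.
by rewrite visitS; case: ifP => // _; apply: avg_ge0.
Qed.

Lemma visit_killing m y z : V z -> ~~ V y -> visit m y z = 0.
Proof.
move=> Vz Vy; case: m => [|m]; last by rewrite visitS Vz.
by rewrite /visit /=; case: eqP Vz Vy => // -> ->.
Qed.

Lemma avg_comm (F : Z2 -> Z2 -> R) y z :
  avg (fun w => avg (F^~ w) y) z = avg (fun w => avg (F w) z) y.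
Proof. by rewrite /avg; field. Qed.

(** Decomposition by the last step, where [visitS] uses the first; comparing the two gives the
    symmetry of the killed walk. *)
Lemma visitSr m y z :
  visit m.+1 y z = avg (fun w => if V w then 0 else visit m w z) y.
Proof.
elim: m z => [|m IH] z; rewrite visitS; have [Vz|Vz] := boolP (V z).
- rewrite -[LHS](avg_cst 0 y); apply: eq_avg => w _.
  by case: ifPn => // Vw; rewrite visit_killing.
- rewrite (_ : avg _ y = avg (fun w => (z == w)%:R) y); last first.
    apply: eq_avg => w _; rewrite /visit /=.
    by case: ifPn => // Vw; case: eqP => // zw; rewrite zw Vw in Vz.
  rewrite /avg /visit /=.
  have E d : (z + d == y) = (z == y - d) by rewrite -(inj_eq (addIr (- d))) addrK.
  rewrite !E !opprK; ring.
- rewrite -[LHS](avg_cst 0 y); apply: eq_avg => w _.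
  by case: ifPn => // Vw; rewrite visit_killing.
- rewrite (_ : avg (visit m.+1 y) z =
    avg (fun w => avg (fun v => if V v then 0 else visit m v w) y) z); last first.
    by apply: eq_avg => w _; exact: IH.
  rewrite (avg_comm (fun v w => if V v then 0 else visit m v w)).
  apply: eq_avg => w _; case: ifPn => Vw; first by rewrite avg_cst.
  by rewrite visitS (negbTE Vz).
Qed.

Lemma visitC m x y : ~~ V x -> ~~ V y -> visit m y x = visit m x y.
Proof.
elim: m x y => [|m IH] x y Vx Vy; first by rewrite /visit /= eq_sym.
rewrite visitS (negbTE Vx) visitSr; apply: eq_avg => w _.
by case: ifPn => Vw; [rewrite visit_killing|rewrite IH].
Qed.

(* Time reversal: the first entrance at y in m + 1 steps. *)
Lemma visit_entrance m x y : ~~ V x ->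
  visit m.+1 y x = avg (visit m x) y.
Proof.
move=> Vx; rewrite visitSr; apply: eq_avg => w _.
by case: ifPn => Vw; [rewrite visit_killing|rewrite visitC].
Qed.

Definition visit_sum y N z : R := \sum_(0 <= m < N) visit m y z.

Lemma visit_sumS y N z :
  visit_sum y N.+1 z = (z == y)%:R + killed (visit_sum y N) z.
Proof.
rewrite /visit_sum big_nat_recl //= /killed; congr (_ + _).
case: ifP => Vz; first by apply: big1 => m _; rewrite visitS Vz.
by rewrite avg_sum; apply: eq_bigr => m _; rewrite visitS Vz.
Qed.

(** Nonnegative supersolutions dominate the Green function; the constant 1 serves for a killing
    point y and [green0] for a pole off the killing set. *)
Lemma visit_sum_le f y : (forall z, 0 <= f z) ->
  (forall z, (z == y)%:R + killed f z <= f z) -> forall N z, visit_sum y N z <= f z.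
Proof.
move=> f0 hf; elim=> [|N IH] z; first by rewrite /visit_sum big_nil.
rewrite visit_sumS; apply: le_trans (hf z); rewrite lerD2l /killed.
by case: ifP => // _; apply: ler_avg => w _.
Qed.

Lemma visit_sum_le1 y N z : V y -> visit_sum y N z <= 1.
Proof.
move=> Vy; apply: (@visit_sum_le (fun=> 1)) => {}z //.
rewrite /killed avg_cst; case: ifPn => Vz; first by rewrite addr0; case: eqP.
by case: eqP => [zy|_]; [rewrite zy Vy in Vz|rewrite add0r].
Qed.

Lemma visit_sum_le_green0 y N z : ~~ V y -> visit_sum y N z <= green0 R z y.
Proof.
move=> Vy; apply: (@visit_sum_le (green0 R ^~ y)) => {}z; first exact: green0_ge0.
rewrite /killed; case: ifPn => Vz.
  by case: eqP => [zy|_]; [rewrite zy (negbTE Vy) in Vz|rewrite add0r green0_ge0].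
by rewrite avg_green0 (negbTE (nkilling_neq0 Vz)) addr0 addrC subrK.
Qed.

(* For a killing point y this is the probability that the walk started from z
   enters the killing set at y. *)
Definition green y z : R := limn (fun N => visit_sum y N z).

Lemma visit_sum_ndecr y z : nondecreasing_seq (fun N => visit_sum y N z).
Proof.
apply/nondecreasing_seqP => N; rewrite /visit_sum big_nat_recr //= lerDl.
exact: visit_ge0.
Qed.

Lemma visit_sum_cvg y z : visit_sum y N z @[N --> \oo] --> green y z.
Proof.
apply: nondecreasing_is_cvgn; first exact: visit_sum_ndecr.
have [Vy|Vy] := boolP (V y).
  by exists 1 => _ [N _ <-]; exact: visit_sum_le1.
by exists (green0 R z y) => _ [N _ <-]; exact: visit_sum_le_green0.
Qed.

Lemma green_ge0 y z : 0 <= green y z.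
Proof.
apply: (@le_trans _ _ (visit_sum y 0 z)).
  by rewrite /visit_sum big_nil.
apply: (@nondecreasing_cvgn_le _ (fun N => visit_sum y N z)).
  exact: visit_sum_ndecr.
by apply: cvgP; apply: visit_sum_cvg.
Qed.

Lemma green_le1 y z : V y -> green y z <= 1.
Proof.
move=> Vy; apply: limr_le; first by apply: cvgP; apply: visit_sum_cvg.
by apply: nearW => N; exact: visit_sum_le1.
Qed.

Lemma green_le_green0 y z : ~~ V y -> green y z <= green0 R z y.
Proof.
move=> Vy; apply: limr_le; first by apply: cvgP; apply: visit_sum_cvg.
by apply: nearW => N; exact: visit_sum_le_green0.
Qed.

Lemma greenE y z : green y z = (z == y)%:R + killed (green y) z.
Proof.
have h1 : visit_sum y N.+1 z @[N --> \oo] --> green y z.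
  by rewrite (cvg_shiftS (fun N => visit_sum y N z)); apply: visit_sum_cvg.
have h2 : visit_sum y N.+1 z @[N --> \oo] --> (z == y)%:R + killed (green y) z.
  under eq_fun do rewrite visit_sumS.
  apply: cvgD; first exact: cvg_cst.
  rewrite /killed; case: ifP => _; first exact: cvg_cst.
  by apply: avg_cvg => w _; apply: visit_sum_cvg.
exact: (cvg_unique _ h1 h2).
Qed.

Lemma green_killing y z : V z -> green y z = (z == y)%:R.
Proof. by move=> Vz; rewrite greenE /killed Vz addr0. Qed.

Lemma avg_green y z : ~~ V z -> avg (green y) z = green y z - (z == y)%:R.
Proof. by move=> /negbTE Vz; rewrite [green y z]greenE /killed Vz addrAC subrr add0r. Qed.

(** [visit_entrance] summed over time, the term of time 0 being zero as x differs from y. A single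
    function, with pole x, thus governs the entrance at every y. *)
Lemma green_entrance x y : ~~ V x -> V y -> green y x = avg (green x) y.
Proof.
move=> Vx Vy.
have h1 : visit_sum y N.+1 x @[N --> \oo] --> green y x.
  by rewrite (cvg_shiftS (fun N => visit_sum y N x)); apply: visit_sum_cvg.
have h2 : visit_sum y N.+1 x @[N --> \oo] --> avg (green x) y.
  have E N : visit_sum y N.+1 x = avg (visit_sum x N) y.
    rewrite /visit_sum big_nat_recl //= {1}/visit /=.
    rewrite (_ : (x == y) = false) ?add0r; last by apply: contraNF Vx => /eqP->.
    by rewrite avg_sum; apply: eq_bigr => m _; exact: visit_entrance.
  under eq_fun do rewrite E.
  by apply: avg_cvg => w _; apply: visit_sum_cvg.
exact: (cvg_unique _ h1 h2).
Qed.

(* Doob transform: a z times the probability that the conditioned walk started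
   from z avoids A up to time N. *)
Definition surviving N : Z2 -> R := iter N killed (fun z => if V z then 0 else a z).

Arguments surviving : simpl never.

Lemma survivingS N z :
  surviving N.+1 z = if V z then 0 else avg (surviving N) z.
Proof. by []. Qed.

Lemma surviving_ge0 N z : 0 <= surviving N z.
Proof.
elim: N z => [|N IH] z; first by rewrite /surviving /=; case: ifP => // _; exact: potential_ge0.
by rewrite survivingS; case: ifP => // _; apply: avg_ge0.
Qed.

Lemma surviving_nincr z : nonincreasing_seq (fun N => surviving N z).
Proof.
apply/nonincreasing_seqP => N; elim: N z => [|N IH] z.
  rewrite survivingS /surviving /=; case: ifPn => // Vz.
  have -> : a z = avg a z.
    by rewrite avg_potential (negbTE (nkilling_neq0 Vz)) addr0.
  apply: ler_avg => w _.
  by case: ifP => // _; exact: potential_ge0.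
by rewrite survivingS [leRHS]survivingS; case: ifP => // _; apply: ler_avg => w _.
Qed.

(** This form gives escape probabilities directly; that it is a minus the mean of a at the entrance
    point is [potential_decomp_green]. *)
Definition escape_potential z : R := limn (fun N => surviving N z).
Local Notation q := escape_potential.

Lemma surviving_cvg z : surviving N z @[N --> \oo] --> q z.
Proof.
apply: nonincreasing_is_cvgn; first exact: surviving_nincr.
by exists 0 => _ [N _ <-]; exact: surviving_ge0.
Qed.

Lemma escape_potential_ge0 z : 0 <= q z.
Proof.
apply: limr_ge; first by apply: cvgP; apply: surviving_cvg.
by apply: nearW => N; exact: surviving_ge0.
Qed.

Lemma escape_potential_le z : q z <= a z.
Proof.
apply: (@le_trans _ _ (surviving 0 z)).
  apply: (@nonincreasing_cvgn_ge _ (fun N => surviving N z)).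
    exact: surviving_nincr.
  by apply: cvgP; apply: surviving_cvg.
by rewrite /surviving /=; case: ifP => // _; exact: potential_ge0.
Qed.

Lemma escape_potential_killed z : q z = killed q z.
Proof.
have h1 : surviving N.+1 z @[N --> \oo] --> q z.
  by rewrite (cvg_shiftS (fun N => surviving N z)); apply: surviving_cvg.
have h2 : surviving N.+1 z @[N --> \oo] --> killed q z.
  under eq_fun do rewrite survivingS.
  rewrite /killed; case: ifP => _; first exact: cvg_cst.
  by apply: avg_cvg => w _; apply: surviving_cvg.
exact: (cvg_unique _ h1 h2).
Qed.

Lemma escape_potential_killing z : V z -> q z = 0.
Proof. by rewrite escape_potential_killed /killed => ->. Qed.

Lemma avg_escape_potential z : ~~ V z -> avg q z = q z.
Proof. by rewrite [q z]escape_potential_killed /killed => /negbTE->. Qed.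

(** Makes a - q bounded, so that uniqueness of bounded harmonic functions applies. With C the sum of
    a over A, a - C is nonpositive on V and harmonic off V, hence stays below [surviving] at all
    times. *)
Lemma escape_potential_ge : exists2 C : R, 0 <= C & forall z, a z - C <= q z.
Proof.
exists (\sum_(y <- A) a y); first by rewrite sumr_ge0 // => y _; exact: potential_ge0.
set C := \sum_(y <- A) _.
have C0 : 0 <= C by rewrite sumr_ge0 // => y _; exact: potential_ge0.
have VC z : V z -> a z <= C.
  move=> /orP[/eqP->|zA]; first by rewrite potential0.
  rewrite /C (big_rem z) //= lerDl sumr_ge0 // => y _; exact: potential_ge0.
have F N z : a z - C <= surviving N z.
  elim: N z => [|N IH] z.
    by rewrite /surviving /=; case: ifP => [/VC|_]; lra.
  rewrite survivingS; case: ifPn => [/VC|Vz]; first by lra.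
  rewrite (_ : a z - C = avg (fun w => a w - C) z); first exact: ler_avg.
  by rewrite avgB avg_cst avg_potential (negbTE (nkilling_neq0 Vz)) addr0.
move=> z; apply: limr_ge; first by apply: cvgP; apply: surviving_cvg.
by apply: nearW => N.
Qed.

Lemma avg_escape_potential_ge0 y : 0 <= avg q y.
Proof. by apply: avg_ge0 => w _; exact: escape_potential_ge0. Qed.

End KilledWalk.

(** * Comparison of the entrance law with the harmonic measure *)

Section Comparison.
Variables (R : realType) (A : seq Z2).
Hypotheses (A_uniq : uniq A) (A0 : 0 \notin A).
Implicit Types (x y z w : Z2) (f : Z2 -> R).
Local Notation a := (@potential R).
Local Notation n := (enorm R).
Local Notation g := (@green0 R).
Local Notation V := (killing A).
Local Notation green := (@green R A).
Local Notation q := (@escape_potential R A).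
Hint Resolve enorm_ge0 : core.

Lemma bounded_harmonic_eq0 (B : pred Z2) f C :
  B 0 -> (forall z, B z -> f z = 0) -> (forall z, ~~ B z -> avg f z = f z) ->
  (forall z, `|f z| <= C) -> forall z, f z = 0.
Proof.
move=> B0 fB fH fC z; apply/eqP; rewrite eq_le; apply/andP; split; last first.
  apply: (@potential_min_principle R B f C) => // w.
  - by move=> /fB->.
  - by move=> /fH->.
  - by have := fC w; rewrite ler_norml => /andP[].
rewrite -oppr_ge0.
apply: (@potential_min_principle R B (fun w => - f w) C) => // w.
- by move=> /fB->; rewrite oppr0.
- move=> /fH fw; rewrite (_ : (fun w => - f w) = (fun w => -1 * f w)).
    by rewrite avgZ fw mulN1r.
  by apply/funext => v; rewrite mulN1r.
- by have := fC w; rewrite ler_norml lerN2 => /andP[].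
Qed.

Lemma nmem_neq0 y : y \in A -> y != 0.
Proof. by move=> yA; apply: contraNneq A0 => <-. Qed.

Lemma sum_indicator (F : Z2 -> R) z :
  \sum_(y <- A) (z == y)%:R * F y = (z \in A)%:R * F z.
Proof.
have [zA|zA] := boolP (z \in A); last first.
  rewrite mul0r big_seq big1 // => y yA.
  by case: eqP => [zy|_]; [rewrite zy yA in zA|rewrite mul0r].
rewrite (bigD1_seq z) //= eqxx big1 ?addr0 // => y.
by rewrite eq_sym => /negbTE->; rewrite mul0r.
Qed.

(* The difference of the two sides is bounded, harmonic off 0 and vanishes at 0. *)
Lemma potential_decomp_green0 z :
  \sum_(y <- A) g z y * avg q y = a z - q z.
Proof.
have [C C0 hC] := escape_potential_ge R A.
apply/esym/eqP; rewrite -subr_eq0; apply/eqP.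
pose f w := a w - q w - \sum_(y <- A) g w y * avg q y.
apply: (@bounded_harmonic_eq0 (pred1 0) f (C + \sum_(y <- A) 2 * a y * avg q y)).
- by rewrite /= eqxx.
- move=> w /eqP->; rewrite /f potential0 escape_potential_killing ?killing0 // subr0.
  by rewrite big1 ?subr0 // => y _; rewrite green00 mul0r.
- move=> w /negbTE /= w0.
  rewrite /f avgB avgB avg_sum avg_potential w0 addr0.
  rewrite (eq_bigr (fun y => g w y * avg q y - (w == y)%:R * avg q y)); last first.
    by move=> y _; rewrite avgZr avg_green0 w0 addr0 mulrBl.
  rewrite sumrB sum_indicator.
  have [wA|wA] := boolP (w \in A).
    by rewrite mul1r [q w]escape_potential_killing ?killing_mem //; ring.
  rewrite mul0r avg_escape_potential ?subr0 //.
  by rewrite /killing w0.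
- move=> w; have h1 := escape_potential_le R A w; have h2 := hC w.
  have S0 : 0 <= \sum_(y <- A) g w y * avg q y.
    by apply: sumr_ge0 => y _; rewrite mulr_ge0 ?green0_ge0 ?avg_escape_potential_ge0.
  have S1 : \sum_(y <- A) g w y * avg q y <= \sum_(y <- A) 2 * a y * avg q y.
    by apply: ler_sum => y _; rewrite ler_wpM2r ?avg_escape_potential_ge0 ?green0_ler.
  by rewrite ler_norml /f; apply/andP; split; lra.
Qed.

(** Optional stopping of a at the entrance into V, to which the origin contributes a(0) = 0. For z
    off V the common value is a(z) times the probability that the conditioned walk enters A, the
    denominator of the conditional law. *)
Lemma potential_decomp_green z :
  \sum_(y <- A) a y * green y z = a z - q z.
Proof.
have [C C0 hC] := escape_potential_ge R A.
apply/esym/eqP; rewrite -subr_eq0; apply/eqP.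
pose f w := a w - q w - \sum_(y <- A) a y * green y w.
apply: (@bounded_harmonic_eq0 V f (C + \sum_(y <- A) a y)).
- exact: killing0.
- move=> w Vw; rewrite /f escape_potential_killing // subr0.
  rewrite (eq_bigr (fun y => (w == y)%:R * a y)); last first.
    by move=> y _; rewrite green_killing // mulrC.
  rewrite sum_indicator; case/orP: Vw => [/eqP->|->]; last by rewrite mul1r subrr.
  by rewrite potential0 mulr0 subrr.
- move=> w Vw; rewrite /f avgB avgB avg_sum avg_potential avg_escape_potential //.
  rewrite (negbTE (nkilling_neq0 Vw)) addr0; congr (_ - _).
  apply: eq_big_seq => y yA; rewrite avgZ avg_green //.
  rewrite (_ : (w == y) = false) ?subr0 //.
  by apply: contraNF Vw => /eqP->; exact: killing_mem.
- move=> w; have h1 := escape_potential_le R A w; have h2 := hC w.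
  have S0 : 0 <= \sum_(y <- A) a y * green y w.
    by apply: sumr_ge0 => y _; rewrite mulr_ge0 ?potential_ge0 ?green_ge0.
  have S1 : \sum_(y <- A) a y * green y w <= \sum_(y <- A) a y.
    rewrite !big_seq; apply: ler_sum => y yA.
    by rewrite ler_piMr ?potential_ge0 // green_le1 // killing_mem.
  by rewrite ler_norml /f; apply/andP; split; lra.
Qed.

(** The poles at x cancel between [green x] and g, and the growth at infinity between q and a; on V,
    [green x] and q vanish, so only the quantity bounded by beta remains there. *)
Lemma green_approx x kappa beta : ~~ V x ->
  {in A, forall y, `|g y x - kappa * a y| <= beta} -> 0 <= beta ->
  forall z, `|green x z - kappa * q z - (g z x - kappa * a z)| <= beta.
Proof.
move=> Vx hb b0 z; have [C C0 hC] := escape_potential_ge R A.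
pose h w := green x w - kappa * q w - (g w x - kappa * a w).
have hV w : V w -> `|h w| <= beta.
  move=> Vw; rewrite /h green_killing // escape_potential_killing //.
  rewrite (_ : (w == x) = false); last by apply: contraNF Vx => /eqP<-.
  rewrite mulr0 subr0 sub0r normrN.
  case/orP: Vw => [/eqP->|/hb//].
  by rewrite green00 potential0 mulr0 subrr normr0.
have hH w : ~~ V w -> avg h w = h w.
  move=> Vw; rewrite /h avgB [X in X - _ = _]avgB [X in _ - X = _]avgB avg_green0.
  rewrite !avgZ avg_green // avg_escape_potential //.
  by rewrite avg_potential (negbTE (nkilling_neq0 Vw)) !addr0; ring.
have hB w : `|h w| <= 2 * a x + `|kappa| * C.
  have -> : h w = green x w - g w x + kappa * (a w - q w) by rewrite /h; ring.
  apply: (le_trans (ler_normD _ _)); apply: lerD.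
    have := green_ge0 R A x w; have := green_le_green0 R w Vx.
    have := green0_ler R w x; rewrite ler_norml => *; apply/andP; split; lra.
  rewrite normrM ler_wpM2l // ger0_norm ?subr_ge0 ?escape_potential_le //.
  by have := hC w; lra.
(* The two signs give the two sides of the absolute value from one application of the minimum
   principle. *)
have F s : s = 1 \/ s = -1 -> 0 <= beta + s * h z.
  move=> hs; have s1 : `|s| = 1 by case: hs => ->; rewrite ?normrN normr1.
  apply: (@potential_min_principle R V (fun w => beta + s * h w) (2 * a x + `|kappa| * C)).
  - exact: killing0.
  - move=> w /hV hw; have : `|s * h w| <= beta by rewrite normrM s1 mul1r.
    by rewrite ler_norml => /andP[]; lra.
  - by move=> w Vw; rewrite avgD avg_cst avgZ hH.
  - move=> w; have : `|s * h w| <= 2 * a x + `|kappa| * C by rewrite normrM s1 mul1r.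
    by rewrite ler_norml => /andP[]; lra.
rewrite -/(h z) ler_norml; have := F 1 (or_introl erefl); have := F (-1) (or_intror erefl).
by move=> ? ?; apply/andP; split; lra.
Qed.

(* green x and kappa * q vanish on the killing set and are harmonic near A, so a
   comparison on the boundary layer of a ball around A passes to A itself; the
   entrance probability and avg q are averages over the neighbours of y. *)
Lemma entrance_approx x y0 (rho kappa beta c : R) : ~~ V x ->
  {in A, forall y, n (y - y0) <= rho} -> rho < n (x - y0) -> 0 <= beta -> 0 < c ->
  {in A, forall y, `|g y x - kappa * a y| <= beta} ->
  (forall w, rho < n (w - y0) <= rho + 1 ->
     `|g w x - kappa * a w| <= beta /\ c <= q w) ->
  {in A, forall y, `|green y x - kappa * avg q y| <= 2 * beta / c * avg q y}.
Proof.
move=> Vx hA hx b0 c0 hb hw.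
(* One beta comes from [green_approx], the other from the hypothesis on the layer; dividing by the
   lower bound c of q makes the error relative to q. *)
pose M := 2 * beta / c; have M0 : 0 <= M by rewrite divr_ge0 ?mulr_ge0 // ltW.
have layer w : rho < n (w - y0) <= rho + 1 -> `|green x w - kappa * q w| <= M * q w.
  move=> /hw[h1 h2]; have h3 := green_approx Vx hb b0 w.
  apply: (@le_trans _ _ (2 * beta)); last by rewrite /M mulrAC ler_pdivlMr // ler_wpM2l // mulr_ge0.
  rewrite -[green x w - _](subrK (g w x - kappa * a w)).
  by apply: (le_trans (ler_normD _ _)); lra.
have [N hN] := enorm_box (rho + n y0).
pose U := [seq z <- box N | ~~ V z & n (z - y0) <= rho].
have UP z : (z \in U) = ~~ V z && (n (z - y0) <= rho).
  rewrite mem_filter; case: (~~ V z) => //=; have [h|//] := leP (n (z - y0)) rho.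
  by rewrite hN //; have := ler_enormD R (z - y0) y0; rewrite subrK; lra.
pose f s z := M * q z + s * (green x z - kappa * q z).
have fV s w : V w -> f s w = 0.
  move=> Vw; rewrite /f green_killing // escape_potential_killing //.
  rewrite (_ : (w == x) = false); last by apply: contraNF Vx => /eqP<-.
  by rewrite !mulr0 subrr mulr0 addr0.
have fL s w : (s = 1 \/ s = -1) -> rho < n (w - y0) <= rho + 1 -> 0 <= f s w.
  by move=> hs /layer; rewrite ler_norml /f => /andP[? ?]; case: hs => ->; lra.
have F s : s = 1 \/ s = -1 -> forall w, n (w - y0) <= rho + 1 -> 0 <= f s w.
  move=> hs w hw1; have [Vw|Vw] := boolP (V w); first by rewrite fV.
  have [hw2|hw2] := leP (n (w - y0)) rho; last by apply: fL; rewrite ?hw2.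
  apply: (@min_principle R U); last by rewrite UP Vw.
  - move=> z; rewrite UP => /andP[Vz hz].
    rewrite /f avgD !avgZ avgB !avgZ avg_green // avg_escape_potential //.
    rewrite (_ : (z == x) = false) ?subr0 //.
    by apply: contraTF hz => /eqP->; rewrite -ltNge.
  - move=> z v; rewrite UP => /andP[Vz hz] vz; rewrite UP negb_and negbK -ltNge.
    move=> /orP[/(fV s)->//|hv]; apply: fL => //; rewrite hv /=.
    have := ler_enormD R (v - z) (z - y0); rewrite subrKA (enorm_nbrs R vz); lra.
move=> y yA; rewrite (green_entrance R Vx (killing_mem yA)).
have FA s : s = 1 \/ s = -1 -> 0 <= M * avg q y + s * (avg (green x) y - kappa * avg q y).
  move=> hs; rewrite -!avgZ -avgB -avgZ -avgD; apply: avg_ge0 => w wy.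
  apply: F hs _ _; have := ler_enormD R (w - y) (y - y0).
  by rewrite subrKA (enorm_nbrs R wy); have := hA y yA; lra.
rewrite ler_norml -/M; have := FA 1 (or_introl erefl); have := FA (-1) (or_intror erefl).
by move=> ? ?; apply/andP; split; lra.
Qed.

(** The factor 8 matches [potential_growth]: 8 q - psi is then bounded below and the minimum
    principle applies off V. The constant C disappears from the conclusion, so it may depend on the
    centre of the barrier. *)
Lemma escape_potential_barrier (psi : Z2 -> R) (C t : R) :
  (forall z, psi z <= avg psi z) -> (forall z, psi z <= 8 * a z + C) ->
  (forall z, V z -> psi z <= t) -> forall z, psi z - t <= 8 * q z.
Proof.
move=> sub bd hV z; have [C' C'0 hC] := escape_potential_ge R A.
rewrite -subr_ge0.
apply: (@potential_min_principle R V (fun w => 8 * q w - (psi w - t)) (8 * C' + C - t)).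
- exact: killing0.
- by move=> w Vw; rewrite escape_potential_killing // mulr0; have := hV w Vw; lra.
- move=> w Vw; rewrite avgB avgZ avgB avg_cst avg_escape_potential //.
  by have := sub w; lra.
- by move=> w; have := bd w; have := hC w; lra.
Qed.

Lemma log_norm_shift y0 : exists C, forall z,
  log_norm R (z - y0) <= 8 * a z + C.
Proof.
exists (ln 8 + ln (2 + 4 * n y0 ^+ 2)) => z.
have := potential_growth R z => h.
suff : log_norm R (z - y0) <= log_norm R z + ln (2 + 4 * n y0 ^+ 2) by lra.
have z2 := sqr_ge0 (n z); have y2 := sqr_ge0 (n y0); have zy2 := sqr_ge0 (n (z - y0)).
have p1 : 0 < n (z - y0) ^+ 2 + 2^-1 by lra.
have p2 : 0 < n z ^+ 2 + 2^-1 by lra.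
have p3 : 0 < 2 + 4 * n y0 ^+ 2 by lra.
rewrite /log_norm -lnM ?posrE // ler_ln ?posrE // ?mulr_gt0 //.
have h1 : n (z - y0) <= n z + n y0 by rewrite -(enormN R y0); exact: ler_enormD.
have h2 : n (z - y0) ^+ 2 <= (n z + n y0) ^+ 2  by apply: lerXn2r; rewrite ?nnegrE ?addr_ge0 ?enorm_ge0.
have h3 := sqr_ge0 (n z - n y0).
have h4 : 0 <= n z ^+ 2 * n y0 ^+ 2 by rewrite mulr_ge0.
nra.
Qed.

End Comparison.

(** * Sets near the origin; lower bound of q around sets far from it *)

Section HarnackComparison.
Variable R : realType.
Implicit Types (A : seq Z2) (x y z w : Z2) (r : R).
Local Notation a := (@potential R).
Local Notation n := (enorm R).
Local Notation g := (@green0 R).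
Local Notation green := (@green R).
Local Notation q := (@escape_potential R).

Lemma entrance_near : exists2 K : R, 0 < K & forall A x y0 r,
  ~~ killing A x -> 1 <= r -> {in A, forall y, n (y - y0) <= r} ->
  n y0 <= 9 * r -> 12 * (r + 1) <= n (x - y0) ->
  {in A, forall y, `|green A y x - avg (q A) y| <=
     K * (r / n (x - y0)) * avg (q A) y}.
Proof.
have [C C1 lip] := potential_lipschitz R.
(* The killing set lies within 9 r of y0 and the layer beyond 10 r, and 100 r^2 + 1/2 >= (6/5) (81
   r^2 + 1/2) for r >= 1. *)
pose c : R := 8^-1 * ln (6 / 5).
have c0 : 0 < c by rewrite mulr_gt0 // ln_gt0 //; lra.
have C0 : 0 < C by lra.
exists (2 * (20 * (12 * C)) / c); first by rewrite divr_gt0 // !mulr_gt0.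
move=> A x y0 r Vx r1 hA hy0 hd y yA.
set d := n (x - y0) in hd *; have d0 : 0 < d by lra.
pose beta := 20 * (12 * C) * (r / d).
have r0 : 0 <= r by lra.
have b0 : 0 <= beta by rewrite !mulr_ge0 ?invr_ge0 ?(ltW C0) ?(ltW d0).
have nx : d - 9 * r <= n x.
  by have := ler_enormB R (x - y0) (- y0); rewrite opprK subrK enormN -/d; lra.
(* Here d >= 12 (r + 1) acts: x and x - w both stay at distance at least d / 12 from the origin. The
   factor 20 is the bound |w| <= 20 r. *)
have hphi w : n (w - y0) <= 10 * r + 1 -> `|g w x - 1 * a w| <= beta.
  move=> hw; have hw0 : n w <= 20 * r.
    by have := ler_enormD R (w - y0) y0; rewrite subrK; lra.
  have hwx : d - (10 * r + 1) <= n (x - w).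
    by have := ler_enormB R (x - y0) (w - y0); rewrite opprB subrKA -/d; lra.
  have -> : g w x - 1 * a w = a x - a (x - w).
    by rewrite /green0 -(potentialN _ (w - x)) opprB; ring.
  have := lip x (x - w) (d / 12); rewrite subKr.
  have F1 : 0 <= d / 12 by lra.
  have F2 : d / 12 <= n x by lra.
  have F3 : d / 12 <= n (x - w) by lra.
  move=> /(_ F1 F2 F3) h.
  have -> : beta = 20 * C * r / (d / 12) by rewrite /beta; field; rewrite gt_eqF.
  rewrite ler_pdivlMr; last by lra.
  apply: (@le_trans _ _ (C * n w)); last first.
    by rewrite (mulrC 20) -mulrA ler_pM2l.
  by apply: le_trans h; rewrite ler_wpM2l //; lra.
have [Cs hCs] := log_norm_shift R y0.
have hq w : 10 * r < n (w - y0) -> c <= q A w.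
  move=> hw; have w2 : 100 * r ^+ 2 <= n (w - y0) ^+ 2.
    have -> : 100 * r ^+ 2 = (10 * r) ^+ 2 by ring.
    by apply: lerXn2r; rewrite ?nnegrE ?enorm_ge0; lra.
  have rr : 1 <= r ^+ 2 by rewrite exprn_ege1.
  pose t := ln (81 * r ^+ 2 + 2^-1).
  have hb : log_norm R (w - y0) - t <= 8 * q A w.
    apply: (@escape_potential_barrier R A (fun z => log_norm R (z - y0)) Cs t) => //.
    - by move=> z; rewrite avg_shift; exact: log_norm_subharmonic.
    - move=> z /orP Vz; have hz : n (z - y0) <= 9 * r.
        case: Vz => [/eqP->|/hA]; last by lra.
        by rewrite sub0r enormN.
      have z2 : n (z - y0) ^+ 2 <= 81 * r ^+ 2.
        have -> : 81 * r ^+ 2 = (9 * r) ^+ 2 by ring.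
        by apply: lerXn2r; rewrite ?nnegrE ?enorm_ge0 //; lra.
      rewrite /log_norm /t ler_ln ?posrE; [lra| |lra].
      by have := sqr_ge0 (n (z - y0)); lra.
  suff : ln (6 / 5) + t <= log_norm R (w - y0) by rewrite /c; lra.
  by rewrite /t /log_norm -lnM ?posrE ?ler_ln ?posrE; lra.
have := @entrance_approx R A x y0 (10 * r) 1 beta c Vx.
move=> /(_ _ _ b0 c0 _ _ y yA).
have -> : 2 * beta / c = 2 * (20 * (12 * C)) / c * (r / d).
  by rewrite /beta; field; rewrite !gt_eqF.
rewrite mul1r; apply => //.
- by move=> v /hA; lra.
- by rewrite -/d; lra.
- by move=> v /hA hv; apply: hphi; lra.
- by move=> w /andP[hw1 hw2]; split; [exact: hphi|exact: hq].
Qed.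

Lemma sqr_le_sqr (u v : R) : 0 <= u -> u <= v -> u ^+ 2 <= v ^+ 2.
Proof. by move=> u0 uv; apply: lerXn2r; rewrite ?nnegrE //; lra. Qed.

(** A logarithm centred at y0 alone is larger at the killing point 0 than on the layer, so the
    barrier is the mean of logarithms centred at y0 and at 0, that is, half the logarithm of a
    product. That product is at least P W on the layer and at most (2/3) P W on the killing set; on
    A this uses |y0| + r <= 2 (|y0| - 4 r), the reason for 9 r. *)
Lemma escape_potential_far A y0 r w :
  1 <= r -> {in A, forall y, n (y - y0) <= r} ->
  9 * r < n y0 -> 3 * r < n (w - y0) <= 4 * r -> 16^-1 * ln (3 / 2) <= q A w.
Proof.
move=> r1 hA hy0 /andP[hw1 hw2].
have [C0 hC0] := log_norm_shift R 0; have [C1 hC1] := log_norm_shift R y0.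
set Y := n y0 in hy0 *.
pose W := (Y - 4 * r) ^+ 2 + 2^-1; pose P := 9 * r ^+ 2 + 2^-1.
have rr : 1 <= r ^+ 2 by rewrite exprn_ege1.
have P0 : 0 < P by rewrite /P; lra.
have W0 : 0 < W by rewrite /W; have := sqr_ge0 (Y - 4 * r); lra.
pose psi z := 2^-1 * (log_norm R (z - y0) + log_norm R z).
pose t := 2^-1 * ln (2 / 3 * P * W).
have lpos z : 0 < n z ^+ 2 + 2^-1 by have := sqr_ge0 (n z); lra.
have psiE z : psi z = 2^-1 * ln ((n (z - y0) ^+ 2 + 2^-1) * (n z ^+ 2 + 2^-1)).
  by rewrite /psi /log_norm lnM ?posrE.
have hb : psi w - t <= 8 * q A w.
  apply: (@escape_potential_barrier R A psi (2^-1 * (C0 + C1)) t) => //.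
  - move=> z; rewrite /psi avgZ avgD avg_shift ler_pM2l //.
    by apply: lerD; exact: log_norm_subharmonic.
  - by move=> z; have := hC0 z; have := hC1 z; rewrite /psi subr0; lra.
  - move=> z Vz; rewrite psiE /t ler_pM2l // ler_ln ?posrE ?mulr_gt0 //.
    case/orP: Vz => [/eqP->|zA].
      rewrite sub0r enormN enorm0 expr0n add0r -/Y.
      have W1 : Y ^+ 2 <= (2 * (Y - 4 * r)) ^+ 2 by apply: sqr_le_sqr; lra.
      have : Y ^+ 2 + 2^-1 <= 4 * W by rewrite /W; move: W1; rewrite exprMn; lra.
      have : 9 <= P by rewrite /P; lra.
      nra.
    have z1 : n (z - y0) ^+ 2 <= r ^+ 2.
      by apply: sqr_le_sqr; [exact: enorm_ge0|exact: hA].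
    have z2 : n z ^+ 2 <= (2 * (Y - 4 * r)) ^+ 2.
      apply: sqr_le_sqr; first exact: enorm_ge0.
      by have := ler_enormD R (z - y0) y0; rewrite subrK -/Y; have := hA z zA; lra.
    apply: (@le_trans _ _ (6^-1 * P * (4 * W))).
      apply: ler_pM; rewrite ?(ltW (lpos _)) // /P /W; first by lra.
      by move: z2; rewrite exprMn; lra.
    by rewrite (_ : 6^-1 * P * (4 * W) = 2 / 3 * P * W) //; field.
  suff : t + 2^-1 * ln (3 / 2) <= psi w by lra.
rewrite /t psiE -mulrDr ler_pM2l // -lnM ?posrE ?mulr_gt0 //.
have -> : 2 / 3 * P * W * (3 / 2) = P * W by field.
rewrite ler_ln ?posrE ?mulr_gt0 //; apply: ler_pM; rewrite ?(ltW P0) ?(ltW W0) //.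
  rewrite /P lerD2r (_ : 9 * _ = (3 * r) ^+ 2); last by ring.
  by apply: sqr_le_sqr; lra.
rewrite /W lerD2r; apply: sqr_le_sqr; first by lra.
by have := ler_enormB R y0 (y0 - w); rewrite subKr enormC -/Y; lra.
Qed.
End HarnackComparison.

(** * Sets whose distance to the origin is large compared with their radius *)

Section FarComparison.
Variable R : realType.
Implicit Types (A : seq Z2) (x y z w : Z2) (r : R).
Local Notation a := (@potential R).
Local Notation n := (enorm R).
Local Notation g := (@green0 R).
Local Notation green := (@green R).
Local Notation q := (@escape_potential R).

Lemma potential_diff_bound (C : R) z w (mu D : R) : 0 < mu -> 0 <= C ->
  (forall mu' : R, 0 <= mu' -> mu' <= n z -> mu' <= n w ->
    `|a z - a w| * (1 + mu') <= C * n (z - w)) ->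
  mu <= n z -> mu <= n w -> n (z - w) <= D -> `|a z - a w| <= C * D / mu.
Proof.
move=> mu0 C0 lip hz hw hD; rewrite ler_pdivlMr //.
apply: (le_trans _ (ler_wpM2l C0 hD)); apply: le_trans (lip mu (ltW mu0) hz hw).
by rewrite ler_wpM2l //; lra.
Qed.

(* kappa makes g ^~ x - kappa * a vanish at both y0 and the origin. *)
Lemma entrance_far : exists2 K : R, 0 < K & forall A x y0 r,
  ~~ killing A x -> 1 <= r -> {in A, forall y, n (y - y0) <= r} ->
  9 * r < n y0 -> n y0 <= 4 * n x -> 5 * r <= n (x - y0) ->
  {in A, forall y, `|green A y x - g y0 x / a y0 * avg (q A) y| <=
     K * (g y0 x / a y0) * (r / n (x - y0)) * avg (q A) y}.
Proof.
have [C C1 lip] := potential_lipschitz R; have [c5 c50 green_ge] := green0_ge R.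
have C0 : 0 < C by lra.
pose c : R := 16^-1 * ln (3 / 2).
have c0 : 0 < c by rewrite mulr_gt0 // ln_gt0 //; lra.
pose K1 := 20 * C + 32 * C * C.
have K10 : 0 < K1 by rewrite addr_gt0 // !mulr_gt0.
exists (2 * (K1 / c5) / c); first by rewrite divr_gt0 // mulr_gt0 // divr_gt0.
move=> A x y0 r Vx r1 hA hy0 hyx hd y yA.
set d := n (x - y0) in hd *; set Y := n y0 in hy0 hyx *.
have d0 : 0 < d by lra. have r0 : 0 < r by lra. have Y0 : 0 < Y by lra.
have y00 : y0 != 0 by apply: contraTneq Y0 => y00; rewrite /Y y00 enorm0 ltxx.
have ay := potential_ge_half R y00; have ay0 : 0 < a y0 by lra.
pose kappa := g y0 x / a y0.
have k5 : c5 <= kappa by rewrite ler_pdivlMr // green_ge.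
pose beta := K1 / c5 * kappa * (r / d).
(* As |y0| <= 4 |x|, kappa is bounded below by c5, so an absolute error of order r / d is also of
   order kappa r / d. *)
have b1 : K1 * (r / d) <= beta.
  rewrite /beta ler_pM2r ?divr_gt0 // -mulrA ler_peMr ?(ltW K10) //.
  by rewrite ler_pdivlMl // mulr1.
have b0 : 0 <= beta by apply: le_trans b1; rewrite !mulr_ge0 ?invr_ge0 // ltW.
have hby0 : `|a x - a (y0 - x)| <= a y0.
  have h1 := green0_ge0 R y0 x; have h2 := green0_lel R y0 x.
  by move: h1 h2; rewrite /green0 ler_norml => *; apply/andP; split; lra.
have hphi w : n (w - y0) <= 4 * r -> `|g w x - kappa * a w| <= beta.
  move=> hw; apply: le_trans b1.
  (* Both terms vanish at w = y0: the first varies on the scale d of the distance to the pole x, the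
     second on the scale Y of the distance to the origin. *)
  have -> : g w x - kappa * a w = - (a (w - x) - a (y0 - x))
      + (a x - a (y0 - x)) * ((a y0 - a w) / a y0).
    by rewrite /kappa /green0; field; rewrite gt_eqF.
  rewrite /K1 (mulrDl (20 * C)); apply: (le_trans (ler_normD _ _)); apply: lerD.
    rewrite normrN (_ : 20 * C * (r / d) = C * (4 * r) / (d / 5)); last first.
      by field; rewrite gt_eqF.
    apply: potential_diff_bound; rewrite ?(ltW C0) //; first by lra.
    - by move=> mu' ? ? ?; exact: lip.
    - have := ler_enormB R (x - y0) (w - y0); rewrite opprB subrKA.
      by rewrite (enormC _ w x) -/d; lra.
    - by rewrite enormC -/d; lra.
    - by rewrite opprB subrKA.
  have hw1 : `|a y0 - a w| <= C * (4 * r) / (Y / 2).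
    apply: potential_diff_bound; rewrite ?(ltW C0) //; first by lra.
    - by move=> mu' ? ? ?; exact: lip.
    - by rewrite -/Y; lra.
    - by have := ler_enormB R y0 (y0 - w); rewrite subKr enormC -/Y; lra.
    - by rewrite enormC.
  rewrite normrM normrM normfV (ger0_norm (ltW ay0)).
  (* If d <= 2 Y, the crude bound a(y0) suffices because r / Y <= 2 r / d. Otherwise the first
     factor is of order Y / d, and the product with r / Y is of order r / d. *)
  have [dY|dY] := leP d (2 * Y).
    apply: (@le_trans _ _ (a y0 * (C * (4 * r) / (Y / 2) / a y0))).
      by apply: ler_pM => //; [rewrite divr_ge0 // ltW|rewrite ler_pM2r ?invr_gt0].
    rewrite (_ : a y0 * _ = 8 * C * r / Y); last by field; rewrite !gt_eqF.
    apply: (@le_trans _ _ (8 * C * r / (d / 2))).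
      rewrite ler_pM2l ?mulr_gt0 // lef_pV2 ?posrE; lra.
    rewrite (_ : 8 * C * r / (d / 2) = 16 * C * (r / d)); last by field; rewrite gt_eqF.
    rewrite ler_pM2r ?divr_gt0 // -mulrA (mulrC 32) (mulrC 16).
    have CC : 0 < C * C by rewrite mulr_gt0.
    by rewrite -mulrA; nra.
  have hx : d / 2 <= n x.
    by have := ler_enormB R (x - y0) (- y0); rewrite opprK subrK enormN -/d -/Y; lra.
  have hb : `|a x - a (y0 - x)| <= C * Y / (d / 2).
    rewrite -(potentialN _ (y0 - x)) opprB.
    apply: potential_diff_bound; rewrite ?(ltW C0) ?subKr //; first by lra.
    - by move=> mu' h1 h2 h3; have := lip x (x - y0) mu' h1 h2 h3; rewrite subKr.
    - by rewrite -/d; lra.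
  apply: (@le_trans _ _ (C * Y / (d / 2) * (C * (4 * r) / (Y / 2) / 2^-1))).
    apply: ler_pM => //; first by rewrite divr_ge0 // ltW.
    by apply: ler_pM => //; rewrite ?invr_ge0 ?(ltW ay0) // lef_pV2 ?posrE.
  rewrite (_ : C * Y / (d / 2) * _ = 32 * C * C * (r / d)) //.
  by field; rewrite !gt_eqF.
have hcls := @entrance_approx R A x y0 (3 * r) kappa beta c Vx.
have := hcls _ _ b0 c0 _ _ y yA.
have -> : 2 * beta / c = 2 * (K1 / c5) / c * kappa * (r / d).
  by rewrite /beta; field; rewrite !gt_eqF.
apply => //.
- by move=> v /hA; lra.
- by rewrite -/d; lra.
- by move=> v /hA hv; apply: hphi; lra.
- move=> w /andP[hw1 hw2]; split; first by apply: hphi; lra.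
  by apply: (@escape_potential_far R A y0 r) => //; rewrite hw1 /=; lra.
Qed.

(* For x close to the origin, apply the minimum principle in the variable x in a
   ball around the origin: the entrance probability and kappa are both harmonic
   in x and vanish at 0. *)
Lemma entrance_far_all : exists2 K : R, 0 < K & forall A x y0 r,
  0 \notin A -> ~~ killing A x -> 1 <= r -> {in A, forall y, n (y - y0) <= r} ->
  9 * r < n y0 -> 5 * r <= n (x - y0) ->
  {in A, forall y, `|green A y x - g y0 x / a y0 * avg (q A) y| <=
     K * (g y0 x / a y0) * (r / n (x - y0)) * avg (q A) y}.
Proof.
have [K K0 hK] := entrance_far; exists (4 * K); first by rewrite mulr_gt0.
move=> A x y0 r A0 Vx r1 hA hy0 hd y yA.
set Y := n y0 in hy0; have Y0 : 0 < Y by lra.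
have y00 : y0 != 0 by apply: contraTneq Y0 => y00; rewrite /Y y00 enorm0 ltxx.
have ay := potential_ge_half R y00; have ay0 : 0 < a y0 by lra.
pose kappa z := g y0 z / a y0; pose Q := avg (q A) y.
have k0 z : 0 <= kappa z by rewrite divr_ge0 ?green0_ge0 // ltW.
have Q0 : 0 <= Q := avg_escape_potential_ge0 R A y.
have [hyx|hyx] := leP Y (4 * n x).
  apply: (le_trans (hK A x y0 r Vx r1 hA hy0 hyx hd y yA)).
  rewrite -/(kappa x) -/Q ler_wpM2r // ler_wpM2r ?divr_ge0 ?enorm_ge0 //; first by lra.
  by rewrite ler_wpM2r //; lra.
have nA z : z \in A -> Y - r <= n z.
  move=> /hA; have := ler_enormB R y0 (y0 - z); rewrite subKr enormC -/Y; lra.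
(* Points of the layer |w| between Y / 4 and Y / 4 + 1 are at distance at least Y / 2 from y0. Since
   |x - y0| <= 2 Y, passing back to |x - y0| costs the factor 4 in the constant. *)
pose e := K * (2 * r / Y); have e0 : 0 <= e by rewrite !(mulr_ge0, invr_ge0) //; lra.
have [N hN] := enorm_box (Y / 4).
pose U := [seq z <- box N | (z != 0) && (4 * n z < Y)].
pose f s z := e * (kappa z * Q) + s * (green A y z - kappa z * Q).
have UP z : (z \in U) = (z != 0) && (4 * n z < Y).
  rewrite mem_filter; case: (z != 0) => //=; case: ltP => //= h.
  by rewrite hN //; lra.
have yV : killing A y := killing_mem yA.
have nzV z : z != 0 -> n z < Y - r -> ~~ killing A z.
  move=> z0 hz; rewrite /killing (negbTE z0) /=.
  by apply/negP => /nA; rewrite leNgt hz.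
have F s : s = 1 \/ s = -1 -> 0 <= f s x.
  move=> hs; apply: (@min_principle R U).
  - move=> z; rewrite UP => /andP[z0 hz].
    have Hk : avg (fun v => kappa v * Q) z = kappa z * Q.
      rewrite avgZr /kappa avgZr (_ : avg (g y0) z = g y0 z) //.
      rewrite (_ : g y0 = g ^~ y0); last by apply/funext => v; rewrite green0C.
      rewrite avg_green0 (negbTE z0) addr0 (_ : (z == y0) = false) ?subr0 //.
      by apply: contraTF hz => /eqP->; rewrite -/Y -leNgt; lra.
    rewrite /f avgD !avgZ avgB Hk avg_green ?nzV //; last by lra.
    rewrite (_ : (z == y) = false) ?subr0 //.
    by apply: contraTF hz => /eqP->; rewrite -leNgt; have := nA y yA; lra.
  - move=> z w; rewrite UP => /andP[z0 hz] wz; rewrite UP negb_and negbK -leNgt.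
    have [w0 _|w0 /= hw] := eqVneq w 0.
      rewrite /f w0 green_killing ?killing0 // (_ : (0 == y) = false); last first.
        by rewrite eq_sym; apply/negbTE/(nmem_neq0 A0).
      by rewrite /kappa green0C green00 !mul0r subrr !mulr0 addr0.
    have hw' : n w <= Y / 4 + 1.
      by have := ler_enormB R w z; rewrite (enorm_nbrs R wz); lra.
    have dw : Y / 2 <= n (w - y0) /\ 5 * r <= n (w - y0).
      by have := ler_enormB R y0 w; rewrite enormC -/Y; lra.
    have Vw : ~~ killing A w by apply: nzV => //; lra.
    have := hK A w y0 r Vw r1 hA hy0 hw dw.2 y yA.
    rewrite -/(kappa w) -/Q => h.
    have : K * kappa w * (r / n (w - y0)) * Q <= e * (kappa w * Q).
      rewrite (_ : _ * Q = K * (r / n (w - y0)) * (kappa w * Q)); last by ring.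
      apply: ler_wpM2r; first by rewrite mulr_ge0.
      rewrite /e ler_pM2l //.
      rewrite (_ : 2 * r / Y = r / (Y / 2)); last by field; rewrite gt_eqF.
      by rewrite ler_pM2l ?lef_pV2 ?posrE; lra.
    move: h; rewrite ler_norml /f => /andP[h1 h2] h3.
    by case: hs => ->; lra.
  - rewrite UP hyx andbT; exact: nkilling_neq0 Vx.
have hF : `|green A y x - kappa x * Q| <= e * (kappa x * Q).
  have := F 1 (or_introl erefl); have := F (-1) (or_intror erefl).
  by rewrite /f ler_norml => ? ?; apply/andP; split; lra.
apply: (le_trans hF); rewrite -/(kappa x) -/Q.
rewrite (_ : 4 * K * _ * _ * Q = 4 * K * (r / n (x - y0)) * (kappa x * Q)); last by ring.
apply: ler_wpM2r; first by rewrite mulr_ge0.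
rewrite /e (mulrC 4) -[leRHS]mulrA ler_pM2l //.
have d0 : 0 < n (x - y0) by lra.
rewrite mulrA ler_pdivlMr // mulrAC ler_pdivrMr // -!mulrA (mulrCA 2 r) (mulrCA 4 r).
rewrite ler_pM2l; last by lra.
by have := ler_enormD R x (- y0); rewrite enormN -/Y; lra.
Qed.

End FarComparison.

(** * From entrance probabilities to the normalised entrance law *)

Section EntranceLaw.
Variable R : realType.
Implicit Types (A : seq Z2) (x y z w : Z2) (r : R).
Local Notation a := (@potential R).
Local Notation n := (enorm R).
Local Notation g := (@green0 R).
Local Notation green := (@green R).
Local Notation q := (@escape_potential R).

Lemma green0_gt0 x z : x != 0 -> z != 0 -> 0 < g x z.
Proof.
have [c c0 hc] := green0_ge R.
wlog xz : x z / n x <= n z => [H x0 z0|x0 z0].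
  have [xz|/ltW zx] := leP (n x) (n z); first exact: H.
  by rewrite green0C; exact: H.
apply: lt_le_trans (hc x z _); last by have := enorm_ge0 R z; lra.
by rewrite mulr_gt0 //; have := potential_ge_half R x0; lra.
Qed.

(** The second estimate is the one that bounds the denominator below. Far from the origin it rests
    on kappa <= 2 when |y| <= 4 |x|, and on kappa a(y0) <= 2 a(x) otherwise, these being the upper
    bounds of [green0] in its two variables. *)
Lemma entrance_harnack : exists2 K : R, 0 < K & exists2 c : R, 0 < c &
  forall A x y0 r, 0 \notin A -> ~~ killing A x -> y0 \in A -> 1 <= r ->
  {in A, forall y, n (y - y0) <= r} -> 12 * (r + 1) <= n (x - y0) ->
  exists2 kappa, 0 < kappa &
  {in A, forall y, `|green A y x - kappa * avg (q A) y| <=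
     K * (r / n (x - y0)) * (kappa * avg (q A) y) /\ c * kappa * a y <= g x y}.
Proof.
have [C C1 lip] := potential_lipschitz R; have [c5 c50 green_ge] := green0_ge R.
have [K1 K10 near] := entrance_near R; have [K2 K20 far] := entrance_far_all R.
have C0 : 0 < C by lra.
exists (K1 + K2); first by rewrite addr_gt0.
have C2 : 0 < 1 + 2 * C by lra.
exists (c5 / (2 * (1 + 2 * C))); first by rewrite divr_gt0 // mulr_gt0.
set c := c5 / _.
have cle : c * (2 * (1 + 2 * C)) = c5 by rewrite /c divfK // mulf_neq0 ?gt_eqF.
have cp : 0 < c by rewrite divr_gt0 // mulr_gt0.
move=> A x y0 r A0 Vx y0A r1 hA hd; set d := n (x - y0) in hd *.
have d0 : 0 < d by lra.
have rd : 0 <= r / d by rewrite divr_ge0; lra.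
have x0 := nkilling_neq0 Vx; have ax := potential_ge_half R x0.
have [hy0|hy0] := leP (n y0) (9 * r).
  exists 1 => // y yA; have Q0 := avg_escape_potential_ge0 R A y.
  rewrite !mul1r mulr1; split.
    apply: (le_trans (near A x y0 r Vx r1 hA hy0 hd y yA)).
    rewrite -/d; apply: ler_wpM2r => //; apply: ler_wpM2r => //; lra.
  rewrite green0C; apply: (@le_trans _ _ (c5 * a y)).
    by apply: ler_wpM2r; [exact: potential_ge0|rewrite -cle; nra].
  apply: green_ge.
  have := ler_enormB R (x - y0) (- y0); rewrite opprK subrK enormN -/d.
  by have := ler_enormD R (y - y0) y0; rewrite subrK; have := hA y yA; lra.
have y00 := nmem_neq0 A0 y0A.
have ay0 := potential_ge_half R y00; have ay0p : 0 < a y0 by lra.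
have hd5 : 5 * r <= n (x - y0) by rewrite -/d; lra.
exists (g y0 x / a y0); first by rewrite divr_gt0 // green0_gt0.
move=> y yA; have Q0 := avg_escape_potential_ge0 R A y.
set kappa := g y0 x / a y0.
have k0 : 0 <= kappa by rewrite divr_ge0 ?green0_ge0 // ltW.
have kap2 : kappa <= 2 by rewrite ler_pdivrMr // green0_lel.
have kapx : kappa * a y0 <= 2 * a x by rewrite /kappa divfK ?gt_eqF // green0_ler.
split.
  apply: (le_trans (far A x y0 r A0 Vx r1 hA hy0 hd5 y yA)).
  rewrite -/kappa -/d (_ : K2 * _ * _ * _ = K2 * (r / d) * (kappa * avg (q A) y)).
    by apply: ler_wpM2r; [rewrite mulr_ge0|apply: ler_wpM2r => //; lra].
  by ring.
have ay := potential_ge0 R y.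
have [yx|xy] := leP (n y) (4 * n x).
  rewrite green0C; apply: (le_trans _ (green_ge _ _ yx)); apply: ler_wpM2r => //.
  by rewrite -cle; apply: ler_wpM2l; [exact: ltW|nra].
apply: (@le_trans _ _ (c5 * a x)); last by apply: green_ge; have := enorm_ge0 R y; lra.
have hay : a y <= a y0 * (1 + 2 * C).
  have hyy : n (y - y0) <= r := hA y yA.
  have rp : 0 < r by lra.
  have ry0 : r <= n y0 by lra.
  have ry : r <= n y by have := ler_enormB R y0 (y0 - y); rewrite subKr enormC; lra.
  have := @potential_diff_bound R C y y0 r r rp (ltW C0) (lip y y0) ry ry0 hyy.
  rewrite mulfK ?(gt_eqF rp) // ler_norml => /andP[_].
  by move: (a y) (a y0) ay0 => u v hv; nra.
apply: (@le_trans _ _ (c * kappa * (a y0 * (1 + 2 * C)))).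
  by apply: ler_wpM2l => //; rewrite mulr_ge0 // ltW.
rewrite -cle (_ : c * kappa * _ = c * (1 + 2 * C) * (kappa * a y0)); last by ring.
rewrite (_ : c * _ * a x = c * (1 + 2 * C) * (2 * a x)); last by ring.
by rewrite ler_pM2l // mulr_gt0.
Qed.

(** The factor kappa cancels in the ratio. As e may be large, T has a lower bound of its own. If S =
    0 then h and X vanish, and so do both sides. *)
Lemma ratio_approx (X h S T c e kappa : R) : 0 < c -> 0 < kappa -> 0 <= h -> 0 <= S ->
  0 <= e -> `|X - kappa * h| <= e * (kappa * h) -> `|T - kappa * S| <= e * (kappa * S) ->
  c * kappa * S <= T -> (S = 0 -> h = 0) ->
  `|X / T - h / S| <= 2 / c * e * (h / S).
Proof.
move=> c0 k0 h0 S0 e0 hX hT cT Sh.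
have [S00|S1] := eqVneq S 0.
  have hh := Sh S00; move: hX; rewrite hh !mulr0 subr0 normr_le0 => /eqP->.
  by rewrite !mul0r subrr normr0 mulr0.
have Sp : 0 < S by rewrite lt_neqAle eq_sym S1.
have T0 : 0 < T by apply: lt_le_trans cT; rewrite !mulr_gt0.
have -> : X / T - h / S = ((X - kappa * h) * S - h * (T - kappa * S)) / (T * S).
  by field; rewrite !gt_eqF.
rewrite normrM normfV (gtr0_norm (mulr_gt0 T0 Sp)) ler_pdivrMr ?mulr_gt0 //.
apply: (@le_trans _ _ (2 * e * kappa * h * S)).
  apply: (le_trans (ler_normB _ _)); rewrite !normrM (gtr0_norm Sp) (ger0_norm h0).
  have h1 := ler_wpM2r S0 hX; have h2 := ler_wpM2l h0 hT.
  apply: (le_trans (lerD h1 h2)); rewrite le_eqVlt; apply/orP; left; apply/eqP; ring.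
have -> : 2 / c * e * (h / S) * (T * S) = 2 * e * h / c * T.
  by field; rewrite !gt_eqF.
have -> : 2 * e * kappa * h * S = 2 * e * h / c * (c * kappa * S).
  by field; rewrite gt_eqF.
by apply: ler_wpM2l => //; rewrite !mulr_ge0 ?invr_ge0 // ltW.
Qed.

Lemma entrance_law_approx : exists2 K : R, 0 < K & forall A x r D,
  uniq A -> 0 \notin A -> ~~ killing A x -> r = 0 \/ 1 <= r ->
  {in A &, forall y y', n (y - y') <= r} -> {in A, forall y, D <= n (x - y)} ->
  12 * (r + 1) <= D ->
  {in A, forall y, let hm := a y * avg (q A) y / (\sum_(v <- A) a v * avg (q A) v) in
    `|a y * green A y x / (a x - q A x) - hm| <= K * hm * (r / D)}.
Proof.
have [K K0 [c c0 harnack]] := entrance_harnack.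
exists (2 / c * K); first by rewrite !mulr_gt0 // invr_gt0.
move=> A x r D Au A0 Vx hr hA hD rD y yA.
set hm := a y * avg (q A) y / _; cbv zeta.
have x0 := nkilling_neq0 Vx.
have T1 := potential_decomp_green0 R Au x.
have T2 := potential_decomp_green R Au x.
have Q0 v : 0 <= avg (q A) v := avg_escape_potential_ge0 R A v.
have S0 : 0 <= \sum_(v <- A) a v * avg (q A) v.
  by apply: sumr_ge0 => v _; rewrite mulr_ge0 ?potential_ge0.
(* For r = 0 the error term is zero and equality is required: A is a single point and both laws give
   it mass 1. *)
have [r0|r1] := hr.
  have AE : A = [:: y].
    have E v : v \in A -> v = y.
      move=> vA; apply/eqP; rewrite -subr_eq0; apply: contraT => /(enorm_ge1 R).
      by have := hA v y vA yA; rewrite r0; lra.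
    case: (A) Au yA E => [//|v [|w B]] /=.
      by rewrite inE => _ /eqP->.
    move=> /andP[vB _] _ E; have vy := E v (mem_head _ _).
    have wy : w = y by apply: E; rewrite !inE eqxx orbT.
    by rewrite vy wy inE eqxx in vB.
  have y0 := nmem_neq0 A0 yA; have ay : 0 < a y by have := potential_ge_half R y0; lra.
  have H z : g z y * avg (q A) y = a z - q A z.
    by have := potential_decomp_green0 R Au z; rewrite AE big_seq1.
  have Qy : 0 < avg (q A) y.
    rewrite lt_neqAle Q0 andbT eq_sym; apply/eqP => Qy.
    have := H y; rewrite Qy mulr0 escape_potential_killing ?killing_mem //; lra.
  have h1 : hm = 1.
    by rewrite /hm {2}AE big_seq1 divff // gt_eqF // mulr_gt0.
  have h2 : a y * green A y x = a x - q A x.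
    by have := T2; rewrite {1}AE big_seq1.
  rewrite h2 divff ?h1 ?subrr ?normr0 ?r0 ?mul0r ?mulr0 //.
  by rewrite -H gt_eqF // mulr_gt0 // green0_gt0.
have r0 : 0 < r by lra.
have D0 : 0 < D by lra.
have hd : 12 * (r + 1) <= n (x - y) := le_trans rD (hD y yA).
have hAy : {in A, forall v, n (v - y) <= r} by move=> v vA; exact: hA.
(* The base point is y itself; kappa may depend on y because it cancels in the ratio. *)
have [kappa k0 hk] := harnack A x y r A0 Vx yA r1 hAy hd.
have d0 : 0 < n (x - y) by lra.
pose e := K * (r / n (x - y)).
have e0 : 0 <= e by rewrite mulr_ge0 ?divr_ge0 // ltW.
have hX v : v \in A -> `|a v * green A v x - kappa * (a v * avg (q A) v)|
    <= e * (kappa * (a v * avg (q A) v)).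
  move=> vA; have [h _] := hk v vA; have av := potential_ge0 R v.
  rewrite mulrCA -mulrBr normrM (ger0_norm av).
  by apply: (le_trans (ler_wpM2l av h)); rewrite -/e; lra.
apply: (@le_trans _ _ (2 / c * e * hm)).
  apply: (@ratio_approx _ _ _ _ c e kappa) => //.
  - by rewrite mulr_ge0 ?potential_ge0.
  - by apply: hX.
  - rewrite -T2 !mulr_sumr -sumrB.
    apply: (le_trans (ler_norm_sum _ _ _)); rewrite !big_seq; apply: ler_sum => v vA.
    exact: hX.
  - rewrite -T1 mulr_sumr !big_seq; apply: ler_sum => v vA.
    rewrite mulrA; apply: ler_wpM2r => //; exact: (hk v vA).2.
  - move=> /eqP; rewrite psumr_eq0; last first.
      by move=> v _; rewrite mulr_ge0 ?potential_ge0.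
    by move=> /allP/(_ y yA)/eqP.
have hm0 : 0 <= hm by rewrite divr_ge0 // mulr_ge0 ?potential_ge0.
rewrite (_ : 2 / c * K * hm * (r / D) = 2 / c * (K * (r / D)) * hm); last by ring.
apply: ler_wpM2r => //; apply: ler_wpM2l; first by rewrite divr_ge0 // ltW.
rewrite /e ler_pM2l // ler_pM2l // lef_pV2 ?posrE //; exact: hD.
Qed.

End EntranceLaw.

(** * Path probabilities of the walks *)

Section MarkovChain.
Context (R : realType) (d : measure_display) (Omega : measurableType d).
Variables (P : probability Omega R) (X : nat -> Omega -> Z2).
Variables (p : Z2 -> Z2 -> R) (x : Z2).
Hypothesis XP : markov_chain P X p x.
Implicit Types (B D : set Omega) (z : nat -> Z2) (w : Z2) (m N : nat).
Implicit Types (E : nat -> Z2 -> bool).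

Definition pr B : R := fine (P B).

Lemma prE B : measurable B -> P B = (pr B)%:E.
Proof. by move=> mB; rewrite /pr fineK // fin_num_measure. Qed.

Lemma pr_ge0 B : 0 <= pr B.
Proof. by rewrite /pr fine_ge0. Qed.

Lemma le_pr B D : measurable B -> measurable D -> B `<=` D -> pr B <= pr D.
Proof. by move=> mB mD BD; rewrite -lee_fin -!prE // le_measure // inE. Qed.

Lemma prU B D : measurable B -> measurable D -> B `&` D = set0 ->
  pr (B `|` D) = pr B + pr D.
Proof.
move=> mB mD BD; apply/EFin_inj; rewrite EFinD -!prE //; last exact: measurableU.
by rewrite measureU.
Qed.

Lemma pr_setI_setC B D : measurable B -> measurable D ->
  pr B = pr (B `&` D) + pr (B `&` ~` D).
Proof.
move=> mB mD; rewrite -prU; [|exact: measurableI| |].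
- by rewrite -setIUr setUCr setIT.
- by apply: measurableI => //; exact: measurableC.
- by rewrite setIACA setICr setI0.
Qed.

Lemma measurable_state m (C : Z2 -> bool) : measurable [set o | C (X m o)].
Proof.
have [mX _ _] := XP.
rewrite (_ : [set o | _] = \bigcup_(k in [set: nat])
   (if unpickle k is Some w then if C w then [set o | X m o = w] else set0 else set0)).
  apply: bigcupT_measurable => k; case: unpickle => // w.
  by case: ifP => // _; exact: mX.
apply/seteqP; split => o /=.
  by move=> Co; exists (pickle (X m o)); [exact: I|rewrite pickleK Co].
by move=> [k _]; case: unpickle => // w; case: ifP => // Cw /= ->.
Qed.

Definition path_event m z : set Omega := [set o | forall i, (i <= m)%N -> X i o = z i].

Definition follows m N E : set Omega :=
  [set o | forall j, (j <= N)%N -> E j (X (m + j) o)].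

Lemma measurable_follows m N E : measurable (follows m N E).
Proof.
rewrite (_ : follows m N E =
  \bigcap_(j in [set j | (j <= N)%N]) [set o | E j (X (m + j) o)]).
  by apply: bigcap_measurable; [exists 0%N|move=> j _; exact: measurable_state].
by apply/seteqP; split => o /= h j; exact: h.
Qed.

Lemma measurable_path_event m z : measurable (path_event m z).
Proof.
rewrite (_ : path_event m z = follows 0 m (fun j w => w == z j)).
  exact: measurable_follows.
by apply/seteqP; split => o /= h j jm; apply/eqP; exact: h.
Qed.

(** Weighted by path probabilities, because the rows of [hat_trans] sum to 1 only off the origin, a
    state that the conditioned walk reaches with probability 0. *)
Hypothesis p_stoch : forall m z,
  pr (path_event m z) * (\sum_(w <- nbrs (z m)) p (z m) w) = pr (path_event m z).

Fixpoint path_prob N E w : R :=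
  if E 0%N w then
    if N is N'.+1 then \sum_(v <- nbrs w) p w v * path_prob N' (fun j => E j.+1) v
    else 1
  else 0.

Lemma pr_in_seq B m (s : seq Z2) : measurable B -> uniq s ->
  pr (B `&` [set o | X m o \in s]) = \sum_(w <- s) pr (B `&` [set o | X m o == w]).
Proof.
move=> mB; elim: s => [|w s IH] /=.
  by rewrite big_nil (_ : B `&` _ = set0) /pr ?measure0 //; apply/seteqP; split => o [].
move=> /andP[ws us]; rewrite big_cons -IH // -prU.
- by rewrite -setIUr; congr (pr (B `&` _)); apply/seteqP; split => o /=;
     rewrite inE => /orP.
- by apply: measurableI => //; exact: (measurable_state m (fun v => v == w)).
- by apply: measurableI => //; exact: (measurable_state m (fun v => v \in s)).
- apply/seteqP; split => o //= [[_ /eqP Xw] [_ Xs]].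
  by rewrite Xw (negbTE ws) in Xs.
Qed.

Lemma nbrs_uniq w : uniq (nbrs w).
Proof.
case: w => i j; rewrite /nbrs /= !inE -!pair_eqE /=.
by rewrite !negb_or !negb_and; lia.
Qed.

Lemma pr_path_eventS m z w :
  pr (path_event m z `&` [set o | X m.+1 o == w]) = pr (path_event m z) * p (z m) w.
Proof.
pose z' i := if (i <= m)%N then z i else w.
have [_ _ /(_ m z')] := XP; rewrite /z' leqnn ltnn.
rewrite -/(path_event m.+1 z') -/(path_event m z').
have -> : path_event m z' = path_event m z.
  by apply/seteqP; split => o h i im; rewrite h // /z' im.
have -> : path_event m.+1 z' = path_event m z `&` [set o | X m.+1 o == w].
  apply/seteqP; split => o /=.
    move=> h; split; last by rewrite h // /z' ltnn.
    by move=> i im; rewrite h ?(leq_trans im) // /z' im.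
  move=> [h /eqP hw] i; rewrite leq_eqVlt => /predU1P[->|im].
    by rewrite /z' ltnn.
  by rewrite /z' -ltnS im h.
have mz := measurable_path_event m z.
have mw : measurable (path_event m z `&` [set o | X m.+1 o == w]).
  apply: measurableI => //; exact: (measurable_state m.+1 (fun v => v == w)).
by rewrite (prE mz) (prE mw) -EFinM => -[].
Qed.

(** Jumps leaving [nbrs] carry no mass, since the row sum over [nbrs] already exhausts the
    probability of the path. *)
Lemma pr_path_event_split m z B : measurable B -> B `<=` path_event m z ->
  pr B = \sum_(w <- nbrs (z m)) pr (B `&` [set o | X m.+1 o == w]).
Proof.
move=> mB Bz; have mN := measurable_state m.+1 (fun v => v \in nbrs (z m)).
have mz := measurable_path_event m z.
rewrite (pr_setI_setC mB mN) -pr_in_seq ?nbrs_uniq //.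
suff -> : pr (B `&` ~` [set o | X m.+1 o \in nbrs (z m)]) = 0 by rewrite addr0.
apply/eqP; rewrite eq_le pr_ge0 andbT.
apply: (@le_trans _ _ (pr (path_event m z `&` ~` [set o | X m.+1 o \in nbrs (z m)]))).
  apply: le_pr; [..|exact: setSI].
  - by apply: measurableI => //; exact: measurableC.
  - by apply: measurableI => //; exact: measurableC.
have := pr_setI_setC mz mN; rewrite pr_in_seq ?nbrs_uniq //.
rewrite (eq_bigr (fun w => pr (path_event m z) * p (z m) w)); last first.
  by move=> w _; exact: pr_path_eventS.
by rewrite -mulr_sumr p_stoch; lra.
Qed.

(** Markov property at time m. The two events share that time: [E 0] tests the last prescribed state
    z m. The induction lengthens the prescribed path by one neighbour. *)
Lemma pr_path_event_follows N m z E :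
  pr (path_event m z `&` follows m N E) = pr (path_event m z) * path_prob N E (z m).
Proof.
elim: N m z E => [|N IH] m z E /=.
  case: ifPn => Ez; rewrite ?mulr1 ?mulr0.
    congr pr; apply/seteqP; split => o /=; first by case.
    by move=> h; split => // j; rewrite leqn0 => /eqP->; rewrite addn0 h.
  rewrite (_ : _ `&` _ = set0) /pr ?measure0 //; apply/seteqP; split => o //= [h].
  by move=> /(_ 0%N isT); rewrite addn0 h // (negbTE Ez).
case: ifPn => Ez; last first.
  rewrite mulr0 (_ : _ `&` _ = set0) /pr ?measure0 //; apply/seteqP; split => o //= [h].
  by move=> /(_ 0%N isT); rewrite addn0 h // (negbTE Ez).
rewrite (@pr_path_event_split m z); last 2 first.
- by apply: measurableI; [exact: measurable_path_event|exact: measurable_follows].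
- by move=> o [].
rewrite mulr_sumr; apply: eq_bigr => w _; rewrite mulrA -pr_path_eventS.
pose z' i := if (i <= m)%N then z i else w.
have E1 : path_event m z `&` [set o | X m.+1 o == w] = path_event m.+1 z'.
  apply/seteqP; split => o /=.
    move=> [h /eqP hw] i; rewrite leq_eqVlt => /predU1P[->|im].
      by rewrite /z' ltnn.
    by rewrite /z' -ltnS im h.
  move=> h; split; last by rewrite h // /z' ltnn.
  by move=> i im; rewrite h ?(leq_trans im) // /z' im.
rewrite E1.
have -> : w = z' m.+1 by rewrite /z' ltnn.
rewrite -IH; congr pr; rewrite -E1 /z' ltnn.
apply/seteqP; split => o /=.
  move=> [[h1 h2] h3]; split => // j jN.
  by have := h2 j.+1 jN; rewrite addnS addSn.
move=> [[h1 h3] h2]; split => //; split => // -[|j] jN.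
  by rewrite addn0 h1.
by rewrite addnS -addSn; exact: h2.
Qed.

Lemma pr_follows N E : pr (follows 0 N E) = path_prob N E x.
Proof.
have [mX X0 _] := XP.
have E0 : path_event 0 (fun=> x) = [set o | X 0 o = x].
  by apply/seteqP; split => o /=; [exact|move=> h i; rewrite leqn0 => /eqP->].
have := pr_path_event_follows N 0 (fun=> x) E.
rewrite E0 {2}/pr X0 mul1r => <-.
have mF := measurable_follows 0 N E; have mx := mX 0%N x.
rewrite (pr_setI_setC mF mx) setIC -[RHS]addr0; congr (_ + _).
apply/eqP; rewrite eq_le pr_ge0 andbT.
apply: (@le_trans _ _ (pr (~` [set o | X 0 o = x]))).
  by apply: le_pr; [apply: measurableI => //; exact: measurableC|exact: measurableC|].
by rewrite /pr probability_setC // X0 subee.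
Qed.

End MarkovChain.

(** * One-step sums of the walks as lattice averages; the potential kernel as a series *)

Section Walks.
Variable R : realType.
Implicit Types (z w x y : Z2) (N m j : nat) (A : seq Z2).
Local Notation a := (@potential R).
Local Notation n := (enorm R).

Lemma sum_nbrs (f : Z2 -> R) z : \sum_(w <- nbrs z) f w = 4 * avg f z.
Proof. by rewrite !big_cons big_nil /avg; lra. Qed.

Lemma sum_srw_trans (f : Z2 -> R) z :
  \sum_(w <- nbrs z) srw_trans R z w * f w = avg f z.
Proof.
rewrite (eq_big_seq (fun w => 4^-1 * f w)) ?sum_nbrs ?avgZ; last first.
  by move=> w wz; rewrite /srw_trans neighbourP wz.
by lra.
Qed.

Lemma sum_hat_trans (f : Z2 -> R) z : z != 0 ->
  \sum_(w <- nbrs z) hat_trans a z w * f w = avg (fun w => a w * f w) z / a z.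
Proof.
move=> z0; have az : 0 < a z by have := potential_ge_half R z0; lra.
rewrite (eq_big_seq (fun w => (4 * a z)^-1 * (a w * f w))); last first.
  by move=> w wz; rewrite /hat_trans neighbourP wz z0 /=; ring.
by rewrite sum_nbrs avgZ; field; rewrite gt_eqF.
Qed.

Lemma potential_kernelE (d : measure_display) (Omega : measurableType d)
    (P : Z2 -> probability Omega R) (S : nat -> Omega -> Z2) :
  is_srw P S -> potential_kernel P S = a.
Proof.
move=> SP; apply/funext => x; rewrite /potential_kernel /potential.
have E k z : fine (P z [set w | S k w = 0]) = srw_prob R k z.
  (* A condition at the single time k, written as a condition on the whole path; shifting time by
     one step turns F (k + 1) into F k. *)
  pose F k : nat -> Z2 -> bool := fun j w => (j == k) ==> (w == 0).
  have st m u : pr (P z) (path_event S m u) *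
      (\sum_(w <- nbrs (u m)) srw_trans R (u m) w) = pr (P z) (path_event S m u).
    rewrite (eq_bigr (fun w => srw_trans R (u m) w * 1)); last first.
      by move=> w _; rewrite mulr1.
    by rewrite sum_srw_trans avg_cst mulr1.
  transitivity (pr (P z) (follows S 0 k (F k))).
    congr (fine (P z _)); apply/seteqP; split => o /=.
      by move=> h j _; rewrite /F add0n; apply/implyP => /eqP->; apply/eqP.
    by move=> /(_ k (leqnn k)); rewrite /F eqxx add0n => /eqP.
  rewrite (pr_follows (SP z) st).
  elim: k z {st} => [|k IH] z /=; first by rewrite /F /=; case: eqP.
  have IH' w : path_prob (srw_trans R) k (F k) w = srw_prob R k w := IH w.
  by rewrite -[RHS]sum_srw_trans; apply: eq_bigr => w _; rewrite -IH'.
congr (limn _); apply/funext => N; rewrite /series /=.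
by apply: eq_bigr => k _; rewrite !E.
Qed.

End Walks.

Lemma min_time_None (Q : set nat) : min_time Q = None <-> forall k, ~ Q k.
Proof.
rewrite /min_time; case: pselect => [exQ|nQ]; split => //.
- by move=> h; exfalso; case: exQ => k; rewrite inE; exact: h.
- by move=> _ k Qk; apply: nQ; exists k; rewrite inE.
Qed.

Lemma min_time_Some (Q : set nat) k :
  min_time Q = Some k <-> Q k /\ forall j, (j < k)%N -> ~ Q j.
Proof.
rewrite /min_time; case: pselect => [exQ|nQ]; split => //.
- move=> -[<-]; case: ex_minnP => m; rewrite inE => Qm hm; split => // j jm Qj.
  by have := hm j; rewrite inE => /(_ Qj); rewrite leqNgt jm.
- move=> [Qk hk]; congr Some; case: ex_minnP => m; rewrite inE => Qm hm.
  apply/eqP; rewrite eqn_leq; apply/andP; split; first by apply: hm; rewrite inE.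
  by rewrite leqNgt; apply/negP => /hk.
- by move=> [Qk _]; exfalso; apply: nQ; exists k; rewrite inE.
Qed.

(** * The conditioned walk as a Doob transform *)

Section ConditionedWalk.
Context (R : realType) (d : measure_display) (Omega : measurableType d).
Variables (P : Z2 -> probability Omega R) (X : nat -> Omega -> Z2).
Local Notation a := (@potential R).
Hypothesis XP : is_conditioned_walk a P X.
Variable A : seq Z2.
Hypothesis A0 : 0 \notin A.
Implicit Types (z w x y : Z2) (N m j : nat).
Local Notation q := (escape_potential R A).

(** A path ending at 0 has probability zero: steps into 0 have weight a(0) = 0, and the start
    differs from 0. Elsewhere the row sum is 1 by harmonicity of a. *)
Lemma hat_stoch x m u : x != 0 ->
  pr (P x) (path_event X m u) * (\sum_(w <- nbrs (u m)) hat_trans a (u m) w)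
  = pr (P x) (path_event X m u).
Proof.
move=> x0; have [mX X0 Xp] := XP x0.
have [um0|um0] := eqVneq (u m) 0.
  suff -> : pr (P x) (path_event X m u) = 0 by rewrite mul0r.
  case: m um0 => [|m] um0.
    have mx := mX 0%N x.
    apply/eqP; rewrite eq_le pr_ge0 andbT.
    apply: (@le_trans _ _ (pr (P x) (~` [set o | X 0 o = x]))).
      apply: le_pr.
      - exact: (measurable_path_event (XP x0)).
      - exact: measurableC.
      - move=> o /= /(_ 0%N isT) h e.
        by move: x0; rewrite -e h um0 eqxx.
    by rewrite /pr probability_setC // X0 subee.
  have := Xp m u; rewrite -/(path_event X m.+1 u) -/(path_event X m u) um0.
  have -> : hat_trans a (u m) 0 = 0.
    by rewrite /hat_trans potential0 mul0r; case: ifP.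
  by rewrite mule0 /pr => ->.
have az : 0 < a (u m) by have := potential_ge_half R um0; lra.
rewrite (eq_bigr (fun w => hat_trans a (u m) w * 1)); last by move=> w _; rewrite mulr1.
rewrite sum_hat_trans //; under [X in avg X _]eq_fun do rewrite mulr1.
by rewrite avg_potential (negbTE um0) addr0 divff ?mulr1 // gt_eqF.
Qed.

Lemma pr_follows_hat x N E : x != 0 ->
  pr (P x) (follows X 0 N E) = path_prob (hat_trans a) N E x.
Proof.
by move=> x0; apply: pr_follows; [exact: XP|move=> m u; exact: hat_stoch].
Qed.

(** Multiplication by a(z) turns a step of the conditioned walk into a plain average, so along a
    path only the values of a at its two ends survive. *)
Lemma path_prob_hat N E z : z != 0 ->
  a z * path_prob (hat_trans a) N.+1 E z =
  if E 0%N z then avg (fun w => a w * path_prob (hat_trans a) N (fun j => E j.+1) w) z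
  else 0.
Proof.
move=> z0; have az : 0 < a z by have := potential_ge_half R z0; lra.
rewrite /=; case: ifP => _; last by rewrite mulr0.
by rewrite sum_hat_trans // mulrC divfK // gt_eqF.
Qed.

Definition avoid : nat -> Z2 -> bool := fun _ z => z \notin A.

Lemma path_prob_avoid N z :
  a z * path_prob (hat_trans a) N avoid z = surviving R A N z.
Proof.
elim: N z => [|N IH] z.
  rewrite /surviving /killing /= /avoid; have [->|z0] := eqVneq z 0.
    by rewrite potential0 mul0r.
  by case: (z \in A); rewrite /= ?mulr1 ?mulr0.
rewrite survivingS /killing; have [->|z0] := eqVneq z 0.
  by rewrite potential0 mul0r.
rewrite path_prob_hat // /avoid /=; case: (z \in A) => //=.
by apply: eq_avg => w _; exact: IH.
Qed.

Definition enter_at N y : nat -> Z2 -> bool :=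
  fun j z => if j == N then z == y else z \notin A.

Lemma path_prob_enter N y z :
  a z * path_prob (hat_trans a) N (enter_at N y) z = a y * visit R A N y z.
Proof.
elim: N z => [|N IH] z.
  rewrite /visit /= /enter_at /=.
  by case: eqP => [->|_]; rewrite ?mulr1 ?mulr0.
rewrite visitS /killing; have [->|z0] := eqVneq z 0.
  by rewrite potential0 mul0r mulr0.
rewrite path_prob_hat // {1}/enter_at /=; case: (z \in A) => /=; first by rewrite mulr0.
by rewrite -avgZ; apply: eq_avg => w _; exact: IH.
Qed.

Lemma fine_cvg (u : nat -> R) (l : R) (v : \bar R) :
  u @ \oo --> l -> (fun k => (u k)%:E) @ \oo --> v -> v = l%:E.
Proof.
move=> ul uv; have ul' : (fun k => (u k)%:E) @ \oo --> l%:E.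
  by apply: cvg_EFin => //; apply: nearW.
exact: (cvg_unique _ uv ul').
Qed.

(** The event splits according to the time of first entrance; each piece is a path event of weight
    a(y) [visit] / a(x), and sigma-additivity matches the limit defining [green]. *)
Lemma pr_enters_at x y : x != 0 -> x \notin A -> y \in A ->
  P x (enters_at X [set` A] y) = (a y * green R A y x / a x)%:E.
Proof.
move=> x0 xA yA; have ax : 0 < a x by have := potential_ge_half R x0; lra.
pose F N := follows X 0 N (enter_at N y).
have mF N : measurable (F N) by exact: (measurable_follows (XP x0)).
have FE : enters_at X [set` A] y = \bigcup_N F N.
  apply/seteqP; split => o.
    move=> [N /min_time_Some[/= XA hA] Xy]; exists N => // j jN.
    rewrite /enter_at add0n; case: eqP => [->|/eqP jN']; first by rewrite Xy.
    by apply/negP; apply: hA; rewrite ltn_neqAle jN' jN.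
  move=> [N _ h]; exists N.
    apply/min_time_Some; split => /=.
      by have := h N (leqnn N); rewrite /enter_at add0n eqxx => /eqP->.
    move=> j jN; have := h j (ltnW jN); rewrite /enter_at add0n.
    by rewrite (ltn_eqF jN) => /negP.
  by have := h N (leqnn N); rewrite /enter_at add0n eqxx => /eqP.
have tF : trivIset setT F.
  have disj i j o : (i < j)%N -> F i o -> F j o -> False.
    move=> ij hi hj; have := hi i (leqnn i); have := hj i (ltnW ij).
    rewrite /enter_at add0n eqxx (ltn_eqF ij) => /negP h /eqP Xy.
    by apply: h; rewrite Xy.
  apply/trivIsetP => i j _ _ ij; apply/seteqP; split => o //= [hi hj].
  by move: ij; rewrite neq_ltn => /orP[/disj/(_ hi hj)|/disj/(_ hj hi)].
have mU : measurable (\bigcup_N F N) by exact: bigcupT_measurable.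
rewrite FE; apply: (@fine_cvg (fun N => a y * visit_sum R A y N x / a x)).
  apply: cvgMr_tmp; apply: cvgMl_tmp; exact: visit_sum_cvg.
rewrite (_ : (fun N => _) = (fun N => \sum_(0 <= k < N) P x (F k))%E).
  exact: (@measure_semi_sigma_additive _ _ _ (P x) F mF tF mU).
apply/funext => N; apply/esym.
rewrite /visit_sum mulr_sumr mulr_suml -sumEFin; apply: eq_bigr => k _.
rewrite (prE _ (mF k)) (pr_follows_hat _ _ x0); congr (_%:E).
by rewrite -path_prob_enter mulrC mulKf // gt_eqF.
Qed.

Lemma pr_avoid_forever x (F : nat -> set Omega) (u : nat -> R) (l : R) : x != 0 ->
  (forall N, measurable (F N)) -> nonincreasing_seq F ->
  (forall N, pr (P x) (F N) = u N) -> u @ \oo --> l -> P x (\bigcap_N F N) = l%:E.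
Proof.
move=> x0 mF dF Fu ul; apply: (fine_cvg ul).
have := @nonincreasing_cvg_mu _ _ _ (P x) F.
move=> /(_ _ mF _ dF) h.
rewrite (_ : (fun k => (u k)%:E) = P x \o F).
  apply: h; last exact: bigcapT_measurable.
  by rewrite (le_lt_trans (probability_le1 _ (mF 0%N))) ?ltry.
by apply/funext => k /=; rewrite (prE _ (mF k)) Fu.
Qed.

Lemma pr_entrance_finite x : x != 0 ->
  P x (entrance_finite X [set` A]) = (1 - q x / a x)%:E.
Proof.
move=> x0; have ax : 0 < a x by have := potential_ge_half R x0; lra.
pose F N := follows X 0 N avoid.
have mF N : measurable (F N) by exact: (measurable_follows (XP x0)).
have FE : entrance_finite X [set` A] = ~` (\bigcap_N F N).
  apply/seteqP; split => o /= h h'; apply: h.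
    by apply/min_time_None => k; have := h' k I k (leqnn k); rewrite /avoid add0n => /negP.
  by move=> N _ j _; rewrite add0n /avoid; apply/negP; move/min_time_None: h' => /(_ j).
rewrite FE probability_setC; last exact: bigcapT_measurable.
rewrite (@pr_avoid_forever x F (fun N => surviving R A N x / a x) (q x / a x)) //.
- apply/nonincreasing_seqP => N; apply/subsetPset => o h j jN.
  by apply: h; exact: leqW.
- move=> N; rewrite (pr_follows_hat _ _ x0) -path_prob_avoid mulrC mulKf //.
  by rewrite gt_eqF.
- by apply: cvgMr_tmp; exact: surviving_cvg.
Qed.

Lemma escape_hat y : y \in A -> escape P X [set` A] y = avg q y / a y.
Proof.
move=> yA; have y0 : y != 0 by apply: contraNneq A0 => <-.
have ay : 0 < a y by have := potential_ge_half R y0; lra.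
(* Hitting times start at 1 and y lies in A, so time 0 is left free; the first step then averages
   [surviving] over the neighbours of y. *)
pose E : nat -> Z2 -> bool := fun j z => if j is _.+1 then z \notin A else true.
pose F N := follows X 0 N.+1 E.
have mF N : measurable (F N) by exact: (measurable_follows (XP y0)).
have FE : [set o | hitting_time X [set` A] o = None] = \bigcap_N F N.
  apply/seteqP; split => o /=.
    move=> /min_time_None h N _ [|j] _ //=; rewrite add0n; apply/negP => hj.
    exact: (h j.+1).
  move=> h; apply/min_time_None => -[|k] [] //= _.
  by have := h k I k.+1 (leqnn _); rewrite /= add0n => /negP.
rewrite /escape FE indicE mem_set //= mulr1.
rewrite (@pr_avoid_forever y F (fun N => avg (surviving R A N) y / a y) (avg q y / a y)) //.
- apply/nonincreasing_seqP => N; apply/subsetPset => o h j jN.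
  by apply: h; exact: leqW.
- move=> N; rewrite (pr_follows_hat _ _ y0).
  have -> : avg (surviving R A N) y = a y * path_prob (hat_trans a) N.+1 E y.
    by rewrite path_prob_hat //=; apply: eq_avg => w _; rewrite -path_prob_avoid.
  by rewrite mulrC mulKf // gt_eqF.
- by apply: cvgMr_tmp; apply: avg_cvg => w _; exact: surviving_cvg.
Qed.

End ConditionedWalk.

(** * Distance, diameter and the final assembly *)

Lemma dist_le (R : realType) (A : set Z2) x y : A y -> dist R x A <= enorm R (x - y).
Proof.
move=> Ay; apply: ge_inf; last by exists y.
by exists 0 => _ [z _ <-]; exact: enorm_ge0.
Qed.

Lemma diam_ge (R : realType) (s : seq Z2) y y' : y \in s -> y' \in s ->
  enorm R (y - y') <= diam R [set` s].
Proof.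
move=> ys y's; apply: sup_upper_bound; last by exists (y, y').
split; first by exists (enorm R (y - y')), (y, y').
exists (\sum_(u <- s) enorm R u + \sum_(u <- s) enorm R u).
have H u : u \in s -> enorm R u <= \sum_(v <- s) enorm R v.
  by move=> us; rewrite (big_rem u) //= lerDl sumr_ge0 // => v _; exact: enorm_ge0.
move=> _ [[u v] [/= us vs] <-].
apply: (le_trans (ler_enormD _ _ _)); rewrite enormN.
by apply: lerD; exact: H.
Qed.

(** Nonzero lattice vectors have norm at least 1. This separates singletons, which need exact
    equality, from sets whose diameter absorbs unit steps. *)
Lemma diam_eq0_or_ge1 (R : realType) (s : seq Z2) : s != [::] ->
  diam R [set` s] = 0 \/ 1 <= diam R [set` s].
Proof.
case: s => // y s _.
have [h|[u [us uy]]] : (forall u, u \in y :: s -> u = y) \/ exists u, u \in y :: s /\ u <> y.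
  by have [|] := pselect (exists u, u \in y :: s /\ u <> y);
    [right|move=> h; left=> u us; apply: contrapT => uy; apply: h; exists u].
- left; rewrite /diam (_ : [set _ | _ in _] = [set 0]) ?sup1 //.
  apply/seteqP; split => t /=.
    by move=> [[u v] [/= /h-> /h->] <-]; rewrite subrr enorm0.
  by move=> ->; exists (y, y); [split; exact: mem_head|rewrite subrr enorm0].
- right; apply: (le_trans (_ : 1 <= enorm R (u - y))).
    by apply: enorm_ge1; rewrite subr_eq0; apply/eqP.
  by apply: diam_ge => //; exact: mem_head.
Qed.

Theorem theorem1p2 (R : realType) :
  exists2 K : R, 0 < K &
  forall (d0 : measure_display) (Omega0 : measurableType d0)
    (P0 : Z2 -> probability Omega0 R) (S : nat -> Omega0 -> Z2)
    (d : measure_display) (Omega : measurableType d)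
    (P : Z2 -> probability Omega R) (Shat : nat -> Omega -> Z2),
  is_srw P0 S ->
  let a := potential_kernel P0 S in
  is_conditioned_walk a P Shat ->
  forall (A : set Z2) (x : Z2),
    A `<=` [set z : Z2 | z != 0] -> finite_set A -> A !=set0 ->
    x != 0 -> ~ A x ->
    12 * (diam R A + 1) <= dist R x A ->
  forall y : Z2, A y ->
    let hm := harmonic_measure a P Shat A y in
    `| cond_prob (P x) (enters_at Shat A y) (entrance_finite Shat A) - hm |
      <= K * hm * (diam R A / dist R x A).
Proof.
have [K K0 hK] := entrance_law_approx R; exists K => //.
move=> d0 Omega0 P0 S d Omega P X SP a; rewrite /a (potential_kernelE SP) => XP {a}.
move=> A x A0 /finite_seqP[s0 AE] _ x0 xA far y yA.
(* Without duplicates, the finitely supported sum in [capacity] is an ordinary sum over the list. *)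
have {}AE : A = [set` undup s0] by rewrite AE; apply/seteqP; split => u /=; rewrite mem_undup.
have := undup_uniq s0; move: (undup s0) AE => s {s0} AE su; subst A.
have s0 : 0 \notin s by apply/negP => /A0 /=.
have xs : x \notin s by apply/negP.
have sn : s != [::] by apply: contraTneq yA => ->.
pose a := potential R; pose Q v := avg (escape_potential R s) v.
have apos v : v != 0 -> 0 < a v by move=> /(potential_ge_half R); rewrite /a; lra.
have spos v : v \in s -> 0 < a v by move=> vs; apply: apos; exact: A0 vs.
(* The escape probability is Q v / a v, which cancels one power of a and gives the weights of
   [entrance_law_approx]. *)
have hes v : v \in s -> a v ^+ 2 * escape P X [set` s] v = a v * Q v.
  move=> vs; rewrite (escape_hat XP s0 vs) /Q -/(a v); field.
  by rewrite gt_eqF // spos.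
have hm : harmonic_measure a P X [set` s] y = a y * Q y / \sum_(v <- s) a v * Q v.
  rewrite /harmonic_measure hes // /capacity -fsbig_seq //; congr (_ / _).
  by apply: eq_big_seq => v; exact: hes.
have ax := apos x x0.
have -> : cond_prob (P x) (enters_at X [set` s] y) (entrance_finite X [set` s]) =
    a y * green R s y x / (a x - escape_potential R s x).
  rewrite /cond_prob (_ : _ `&` _ = enters_at X [set` s] y); last first.
    by apply/setIidPl => o [k hk _]; rewrite /entrance_finite /= hk.
  rewrite (pr_enters_at XP x0 xs yA) (pr_entrance_finite XP _ x0) /= -/a.
  have -> : 1 - escape_potential R s x / a x = (a x - escape_potential R s x) / a x.
    by field; rewrite gt_eqF.
  by rewrite invfM invrK mulrACA mulVf ?mulr1 // gt_eqF.
rewrite -/a hm; apply: hK => //.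
- by rewrite /killing (negbTE x0).
- exact: diam_eq0_or_ge1.
- by move=> u v us vs; exact: diam_ge.
- by move=> v vs; exact: dist_le.
Qed.
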